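(* Let $\mu,\nu$ be probability measures on $\mathcal{X}$ with $\mu\ll\nu$. Then $\lim_{n\to\infty}E^\mu[\|\pi_n^\mu-\pi_n^\nu\|_{TV}]=0$ if and only if $\lim_{n\to\infty}E^\mu[\|\pi_{n-}^\mu-\pi_{n-}^\nu\|_{TV}]=0$.
   Context: Setting: $\mathcal{X},\mathcal{Y},\mathcal{Z}$ are Polish spaces. $T$ is a transition kernel on $\mathcal{X}$; $\{Z_n\}$ is i.i.d. with law $Q$, independent of the states; $h:\mathcal{X}\times\mathcal{Z}\to\mathcal{Y}$ measurable. $\{X_n\}$ is a Markov chain with kernel $T$, $X_0\sim\mu$, $Y_n=h(X_n,Z_n)$; $P^\mu$, $E^\mu$ are the joint law and expectation. Predictor $\pi_{n-}^{\mu}=P^{\mu}(X_n\in\cdot\mid Y_0,\dots,Y_{n-1})$; filter $\pi_n^{\mu}=P^{\mu}(X_n\in\cdot\mid Y_0,\dots,Y_n)$. Total variation: $\|P-R\|_{TV}=\sup_{\|f\|_\infty\le1}|\int f\,dP-\int f\,dR|$ over measurable $f$. *)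

(* Defs.v *)
From HB Require Import structures.
From mathcomp Require Import all_boot all_order all_algebra.
From mathcomp Require Import all_classical all_reals all_analysis.
From mathcomp Require Import measurable_realfun.
Set Implicit Arguments. Unset Strict Implicit. Unset Printing Implicit Defensive.
Import Order.TTheory GRing.Theory Num.Theory.
Local Open Scope classical_set_scope.
Local Open Scope ring_scope.

Definition polish_measurable (R : realType) d (T : measurableType d) : Prop :=
  exists dist : T -> T -> R,
  [/\ (forall x y, 0 <= dist x y),
      (forall x y, dist x y = 0 <-> x = y),
      (forall x y, dist x y = dist y x) &
      (forall x y z, dist x z <= dist x y + dist y z)] /\
  [/\
      (forall u : nat -> T,
          (forall e, 0 < e -> exists N, forall m n, (N <= m)%N -> (N <= n)%N ->
             dist (u m) (u n) < e) ->
          exists x, forall e, 0 < e -> exists N, forall n, (N <= n)%N -> dist (u n) x < e),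
      (exists D : set T, countable D /\
          forall x e, 0 < e -> exists2 y, D y & dist x y < e) &
      (@measurable d T =
         <<s [set U : set T | forall x, U x ->
                exists2 e, 0 < e & [set y | dist x y < e] `<=` U] >>)].

Definition TV (R : realType) d (T : measurableType d) (P P' : probability T R) : \bar R :=
  ereal_sup [set (`| \int[P]_x (f x)%:E - \int[P']_x (f x)%:E |)%E
             | f in [set f : T -> R | measurable_fun setT f /\ forall x, `|f x| <= 1]].

(* chain_prob T m A x = P(X_1 in A 1, ..., X_m in A m | X_0 = x) for the Markov
   chain with kernel T. *)
Fixpoint chain_prob (R : realType) d (X : measurableType d) (T : R.-pker X ~> X)
    (m : nat) (A : nat -> set X) (x : X) : \bar R :=
  match m with
  | 0 => 1%E
  | m'.+1 => \int[T x]_(y in A 1%N) chain_prob T m' (fun i => A i.+1) y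
  end.

(* Under P, (X_n) is a Markov chain with kernel T and initial law mu, and
   (Z_n) is i.i.d. with law Q, independent of (X_n): all finite-dimensional
   distributions on rectangles are prescribed. *)
Definition hmm_law (R : realType) dX dZ dO (X : measurableType dX)
    (Z : measurableType dZ) (O : measurableType dO) (P : probability O R)
    (mu : probability X R) (T : R.-pker X ~> X) (Q : probability Z R)
    (Xs : nat -> O -> X) (Zs : nat -> O -> Z) : Prop :=
  forall (n : nat) (A : nat -> set X) (B : nat -> set Z),
    (forall i, measurable (A i)) -> (forall i, measurable (B i)) ->
    P (\bigcap_(i in [set i | (i <= n)%N]) (Xs i @^-1` A i `&` Zs i @^-1` B i)) =
    ((\int[mu]_(x in A 0%N) chain_prob T n A x) * \prod_(i < n.+1) Q (B i))%E.

Definition obs dX dZ dY (X : measurableType dX) (Z : measurableType dZ)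
    (Y : measurableType dY) (O : Type) (h : X * Z -> Y)
    (Xs : nat -> O -> X) (Zs : nat -> O -> Z) : nat -> O -> Y :=
  fun n w => h (Xs n w, Zs n w).

Definition obs_sigma dY (Y : measurableType dY) (O : Type)
    (Ys : nat -> O -> Y) (n : nat) : set (set O) :=
  <<s [set A | exists i B, [/\ (i < n)%N, measurable B & A = Ys i @^-1` B]] >>.

Definition is_cond_dist (R : realType) dX dO (X : measurableType dX)
    (O : measurableType dO) (P : probability O R) (G : set (set O))
    (Xn : O -> X) (pi : O -> probability X R) : Prop :=
  (forall B : set X, measurable B -> forall V : set (\bar R), measurable V ->
      G ((fun w => pi w B) @^-1` V)) /\
  (forall B : set X, measurable B -> forall A, G A ->
      P (A `&` Xn @^-1` B) = (\int[P]_(w in A) pi w B)%E).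

(* Main.v *)
Require Import Defs.
From HB Require Import structures.
From mathcomp Require Import all_boot all_order all_algebra.
From mathcomp Require Import finmap.
From mathcomp Require Import all_classical all_reals all_analysis.
From mathcomp Require Import measurable_realfun.
From mathcomp Require Import ring lra.
Import Order.TTheory GRing.Theory Num.Theory.
Import numFieldNormedType.Exports.
Local Open Scope classical_set_scope.
Local Open Scope ring_scope.

(* Let D = (dmu/dnu)(X_0), the density of P^mu with respect to P^nu. If G is a
   sigma-algebra of observations, then
     E^mu || P^mu(X_n in . | G) - P^nu(X_n in . | G) ||_TV
       = E^nu | E^nu[D | G, X_n] - E^nu[D | G] |.
   Write G_n = sigma(Y_0, ..., Y_{n-1}). Given X_n, the observation Y_n depends only on
   the independent noise Z_n, so E^nu[D | G_{n+1}, X_n] = E^nu[D | G_n, X_n] =: M_n.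
   With a_n = E^nu[D | G_n], the two expected distances are thus E^nu |M_n - a_n| for the
   predictor and E^nu |M_n - a_{n+1}| for the filter, and they differ by at most
   E^nu |a_n - a_{n+1}|. This tends to 0: up to a small L^1 error D may be replaced by
   min(D, K), and the increments of a bounded martingale are orthogonal in L^2. *)

Set Implicit Arguments.
Unset Strict Implicit.
Unset Printing Implicit Defensive.

(** * Positive functions and weighted measures *)

(** The formula for the expected distance is Bayes' rule. Let [phi] and [a] be the densities of P^mu
    with respect to P^nu on sigma(G, X_n) and on G. For almost every w, the conditional law under mu
    multiplied by [a w] is the conditional law under nu weighted by [phi (w, .)]. The distance of
    the two laws is then 1 / [a w] times the integral of |phi - a|, and averaging under P^mu = a
    P^nu cancels that factor. Three points need care. Bayes' rule holds off a null set that depends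
    on the test set; a countable pi-system generating the sigma-algebra of X leaves a single null
    set. The set where [a] vanishes is null under P^mu but perhaps not under P^nu. Finally, the
    distance is a supremum over uncountably many test functions and is not known to be measurable in
    w, so it is exchanged for a measurable function by an argument that asks for no measurability.
    Conditioning on a sigma-algebra is treated as conditioning on a map: the identity from O to O
    with the smaller sigma-algebra. *)

Section nonnegative_induction.
Context d (T : measurableType d) (R : realType).
Variable C : (T -> \bar R) -> Prop.
Hypothesis C_indic : forall A, measurable A -> C (EFin \o \1_A).
Hypothesis C_scale : forall (r : R) f, 0 <= r -> measurable_fun setT f ->
  (forall x, 0 <= f x)%E -> C f -> C (fun x => r%:E * f x)%E.
Hypothesis C_add : forall f g, measurable_fun setT f -> measurable_fun setT g ->
  (forall x, 0 <= f x)%E -> (forall x, 0 <= g x)%E -> C f -> C g ->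
  C (fun x => f x + g x)%E.
Hypothesis C_lim : forall f_ : nat -> T -> \bar R,
  (forall n, measurable_fun setT (f_ n)) -> (forall n x, 0 <= f_ n x)%E ->
  (forall x, nondecreasing_seq (f_ ^~ x)) -> (forall n, C (f_ n)) ->
  C (fun x => limn (f_ ^~ x)).

Import HBNNSimple.

(** The simple functions of [nnsfun_approx] increase to [f], and each is a finite sum, over its
    range, of nonnegative multiples of indicators. *)
Lemma nonneg_measurable_ind f : measurable_fun setT f ->
  (forall x, 0 <= f x)%E -> C f.
Proof.
move=> mf f0; pose h := nnsfun_approx measurableT mf.
rewrite (_ : f = fun x => limn (fun n => (h n x)%:E)); last first.
  by apply/funext => x; apply/esym/cvg_lim => //; exact: cvg_nnsfun_approx.
apply: (@C_lim (fun n x => (h n x)%:E)).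
- by move=> n; exact/measurable_EFinP.
- by move=> n x; rewrite lee_fin.
- by move=> x a b ab; rewrite lee_fin; exact/lefP/nd_nnsfun_approx.
move=> n; set g := h n.
have -> : (fun x => (g x)%:E) =
    (fun x => \sum_(r <- fset_set (range g)) (r * \1_(g @^-1` [set r]) x)%:E)%E.
  apply/funext => x; rewrite fimfunE fsbig_finite; last exact: fimfunP.
  by rewrite sumEFin.
have : forall r, r \in fset_set (range g) -> 0 <= r.
  by move=> r; rewrite in_fset_set // => /set_mem[x _ <-].
(* Generalised from the range of [g] to any list of nonnegative reals, so that induction on the list
   applies; the empty sum is the indicator of [set0]. *)
suff H (s : seq R) : (forall r, r \in s -> 0 <= r) ->
    C (fun x => \sum_(r <- s) (r * \1_(g @^-1` [set r]) x)%:E)%E.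
  by apply: H.
elim: s => [_|r s IH Hs].
  rewrite (_ : (fun _ => _) = EFin \o \1_(set0 : set T)) //; first exact: C_indic.
  by apply/funext => x; rewrite big_nil /= indic0.
under eq_fun do rewrite big_cons.
have r0 : 0 <= r by apply: Hs; rewrite mem_head.
have mI a : measurable_fun setT (EFin \o \1_(g @^-1` [set a]) : T -> \bar R).
  exact/measurable_EFinP/measurable_indic.
apply: C_add.
- exact/measurable_EFinP/measurable_funM.
- by apply: emeasurable_sum => a; exact/measurable_EFinP/measurable_funM.
- by move=> x; rewrite lee_fin mulr_ge0.
- move=> x; rewrite big_seq; apply: sume_ge0 => a sa.
  by rewrite lee_fin mulr_ge0 // Hs // in_cons sa orbT.
- under eq_fun do rewrite EFinM.
  apply: (C_scale r0 (mI r)); first by move=> x; rewrite /= lee_fin.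
  by apply: C_indic; rewrite -[X in measurable X]setTI; exact: measurable_funP.
- by apply: IH => a sa; apply: Hs; rewrite in_cons sa orbT.
Qed.

End nonnegative_induction.

Section integral_change.
Context d1 d2 d (T1 : measurableType d1) (T2 : measurableType d2)
  (W : measurableType d) (R : realType).
Variables (P1 : {measure set T1 -> \bar R}) (P2 : {measure set T2 -> \bar R}).
Variables (e1 : T1 -> W) (e2 : T2 -> W) (u1 : T1 -> R) (u2 : T2 -> R).
Hypotheses (me1 : measurable_fun setT e1) (me2 : measurable_fun setT e2).
Hypotheses (mu1 : measurable_fun setT u1) (mu2 : measurable_fun setT u2).
Hypotheses (u1_ge0 : forall x, 0 <= u1 x) (u2_ge0 : forall x, 0 <= u2 x).

Lemma integral_setI_weight d0 (T : measurableType d0) (P : {measure set T -> \bar R})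
  (e : T -> W) (u : T -> R) (A : set W) :
  (\int[P]_(x in e @^-1` A) (u x)%:E =
   \int[P]_x ((\1_A (e x))%:E * (u x)%:E))%E.
Proof.
rewrite integral_mkcond; apply: eq_integral => x _.
rewrite patchE indicE; have -> : (x \in e @^-1` A) = (e x \in A).
  by apply/idP/idP; rewrite !inE.
by case: ifP; rewrite ?mul1e ?mul0e.
Qed.

(** Two weighted image measures that agree on sets give the same integrals. According to the weights
    (1, a density, an indicator, a conditional expectation) this is a change of variables, a change
    of measure, or the rule that a known factor may be taken out of a conditional expectation. *)
Lemma integral_change (g : W -> \bar R) :
  (forall A, measurable A -> \int[P1]_(x in e1 @^-1` A) (u1 x)%:E =
     \int[P2]_(x in e2 @^-1` A) (u2 x)%:E)%E ->
  measurable_fun setT g -> (forall x, 0 <= g x)%E ->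
  (\int[P1]_x (g (e1 x) * (u1 x)%:E) = \int[P2]_x (g (e2 x) * (u2 x)%:E))%E.
Proof.
move=> H mg g0.
have mM d0 (T : measurableType d0) (e : T -> W) (u : T -> R) f :
    measurable_fun setT e -> measurable_fun setT u -> measurable_fun setT f ->
    measurable_fun setT (fun x => f (e x) * (u x)%:E)%E.
  move=> me mu mf; apply: emeasurable_funM; last exact/measurable_EFinP.
  exact: measurableT_comp.
move: g mg g0; apply: nonneg_measurable_ind.
- by move=> A mA; rewrite /= -!integral_setI_weight; exact: H.
- move=> r f r0 mf f0 IH.
  under eq_integral do rewrite -muleA.
  under [RHS]eq_integral do rewrite -muleA.
  by rewrite !ge0_integralZl_EFin ?IH //; try (by move=> x _; rewrite mule_ge0 // lee_fin);
    first [exact: (mM _ _ e1 u1) | exact: (mM _ _ e2 u2)].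
- move=> f g mf mg f0 g0 IHf IHg.
  under eq_integral do rewrite ge0_muleDl //.
  under [RHS]eq_integral do rewrite ge0_muleDl //.
  by rewrite !ge0_integralD ?IHf ?IHg //; try (by move=> x _; rewrite mule_ge0 // lee_fin);
    first [exact: (mM _ _ e1 u1) | exact: (mM _ _ e2 u2)].
- move=> f_ mf f0 ndf IH.
  have key d0 (T : measurableType d0) (P : {measure set T -> \bar R}) (e : T -> W)
      (u : T -> R) : measurable_fun setT e -> measurable_fun setT u ->
      (forall x, 0 <= u x) ->
      (\int[P]_x (limn (f_ ^~ (e x)) * (u x)%:E) =
       limn (fun n => \int[P]_x (f_ n (e x) * (u x)%:E)))%E.
    move=> me mu u0; rewrite -monotone_convergence //.
    + apply: eq_integral => x _; apply/esym/cvg_lim => //.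
      by apply: cvgeZr => //; exact: ereal_nondecreasing_is_cvgn.
    + by move=> n; exact: (mM _ _ e u (f_ n)).
    + by move=> n x _; rewrite mule_ge0 // lee_fin.
    + by move=> x _ a b ab; rewrite lee_wpmul2r ?lee_fin //; exact: ndf.
  by rewrite !key //; congr (limn _); apply/funext => n; exact: IH.
Qed.

End integral_change.

Section weighted_image.
Context d d' (T : measurableType d) (W : measurableType d') (R : realType)
  (P : {measure set T -> \bar R}) (e : T -> W) (u : T -> R).
(** The image under [e] of the measure with density [u]. The proofs are arguments so that the
    measure structure can be inferred from the term itself; [finite_weighted_image] takes the
    finiteness proof for the same reason. *)
Definition weighted_image (me : measurable_fun setT e) (mu : measurable_fun setT u)
  (u0 : forall x, 0 <= u x) (A : set W) : \bar R :=
  (\int[P]_(x in e @^-1` A) (u x)%:E)%E.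
Hypotheses (me : measurable_fun setT e) (mu : measurable_fun setT u).
Hypothesis u0 : forall x, 0 <= u x.
Let w0 : weighted_image me mu u0 set0 = 0%E.
Proof. by rewrite /weighted_image preimage_set0 integral_set0. Qed.
Let wge0 A : (0 <= weighted_image me mu u0 A)%E.
Proof. by apply: integral_ge0 => x _; rewrite lee_fin. Qed.
Let wsigma : semi_sigma_additive (weighted_image me mu u0).
Proof.
move=> F mF tF mUF; rewrite /weighted_image preimage_bigcup.
have mF' k : measurable (e @^-1` F k) by rewrite -[X in measurable X]setTI; exact: me.
rewrite ge0_integral_bigcup //.
- apply: is_cvg_ereal_nneg_natsum => n _.
  by apply: integral_ge0 => x _; rewrite lee_fin.
- exact/measurable_funTS/measurable_EFinP.
- by move=> x _; rewrite lee_fin.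
- move=> i j _ _ [x [Fi Fj]]; apply: tF => //; by exists (e x).
Qed.
HB.instance Definition _ :=
  isMeasure.Build _ _ _ (weighted_image me mu u0) w0 wge0 wsigma.

Definition finite_weighted_image (_ : (\int[P]_x (u x)%:E < +oo)%E) :=
  weighted_image me mu u0.
Hypothesis fin : (\int[P]_x (u x)%:E < +oo)%E.
HB.instance Definition _ := Measure.on (finite_weighted_image fin).
Let wfin : fin_num_fun (finite_weighted_image fin).
Proof.
exact: lty_fin_num_fun.
Qed.
HB.instance Definition _ :=
  @Measure_isFinite.Build _ _ _ (finite_weighted_image fin) wfin.
End weighted_image.

(** Uniqueness of measures on a pi-system, for two measures given by densities. The constant
    sequence [setT] is the exhaustion by generators of finite mass. *)
Lemma weighted_pi_unique d (T : measurableType d) (R : realType)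
  (P1 P2 : {measure set T -> \bar R}) (u1 u2 : T -> R) (G : set (set T)) :
  measurable_fun setT u1 -> measurable_fun setT u2 ->
  (forall x, 0 <= u1 x) -> (forall x, 0 <= u2 x) ->
  G `<=` measurable -> setI_closed G -> G setT ->
  (\int[P1]_x (u1 x)%:E < +oo)%E ->
  (forall A, G A -> \int[P1]_(x in A) (u1 x)%:E = \int[P2]_(x in A) (u2 x)%:E)%E ->
  forall A, <<s G >> A ->
    (\int[P1]_(x in A) (u1 x)%:E = \int[P2]_(x in A) (u2 x)%:E)%E.
Proof.
move=> mu1 mu2 u10 u20 Gm GI GT fin H A sA.
apply: (@g_sigma_algebra_measure_unique _ _ _ G Gm (fun=> setT) _ _
  (weighted_image P1 (@measurable_id _ T setT) mu1 u10)
  (weighted_image P2 (@measurable_id _ T setT) mu2 u20)) => //.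
by apply/seteqP; split => // x _; exists 0%N.
Qed.

Lemma integral_one d (T : measurableType d) (R : realType)
  (P : {measure set T -> \bar R}) (A : set T) : measurable A ->
  (\int[P]_(x in A) (1 : R)%:E = P A)%E.
Proof. by move=> mA; rewrite integral_cst // mul1e. Qed.

(** * Conditional expectations and disintegration *)

Lemma preimage_measurable d d' (T : measurableType d) (W : measurableType d')
  (e : T -> W) (A : set W) : measurable_fun setT e -> measurable A ->
  measurable (e @^-1` A).
Proof. by move=> me mA; rewrite -[X in measurable X]setTI; exact: me. Qed.

(* The Radon-Nikodym derivative of the image under e of D P with respect to the
   image of P: E[D | e] written as a function of e. *)
Lemma conditional_expectation d d' (T : measurableType d) (W : measurableType d')
  (R : realType) (P : probability T R) (e : T -> W) (D : T -> R) :
  measurable_fun setT e -> measurable_fun setT D -> (forall x, 0 <= D x) ->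
  (\int[P]_x (D x)%:E < +oo)%E ->
  exists b : W -> R, [/\ measurable_fun setT b, (forall w, 0 <= b w) &
    forall S, measurable S -> (\int[P]_(x in e @^-1` S) (D x)%:E =
      \int[P]_(x in e @^-1` S) (b (e x))%:E)%E].
Proof.
move=> me mD D0 fin.
have fin1 : (\int[P]_x (1 : R)%:E < +oo)%E.
  by rewrite integral_one // -ge0_fin_numE // fin_num_measure.
have m1T : measurable_fun setT (fun _ : T => 1 : R) by [].
have m1W : measurable_fun setT (fun _ : W => 1 : R) by [].
have c0 (x : T) : 0 <= (1 : R) by exact: ler01.
pose mu : {finite_measure set W -> \bar R} :=
  finite_weighted_image me m1T c0 fin1.
pose nu : {finite_measure set W -> \bar R} :=
  finite_weighted_image me mD D0 fin.
have mpre A : measurable A -> measurable (e @^-1` A) by exact: preimage_measurable.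
have muE A : measurable A -> mu A = P (e @^-1` A).
  by move=> mA; exact: (integral_one P (mpre _ mA)).
have numu : nu `<< mu.
  move=> A nA B mB BA.
  have : mu B = 0%E by exact: nA.
  rewrite muE // => PB.
  rewrite (_ : nu B = \int[P]_(x in e @^-1` B) (D x)%:E)%E //.
  rewrite (ge0_negligible_integral (mpre _ mB) (mpre _ mB) _ _ PB).
  - by rewrite setDv integral_set0.
  - exact/measurable_funTS/measurable_EFinP.
  - by move=> x _; rewrite lee_fin.
have [f [f0 ffin fint fE]] := radon_nikodym_sigma_finite numu.
have mf : measurable_fun setT f by exact: measurable_int fint.
exists (fine \o f); split.
- exact: measurableT_comp.
- by move=> w; exact: fine_ge0.
move=> S mS.
rewrite (_ : \int[P]_(x in e @^-1` S) (D x)%:E = \int[mu]_(x in S) f x)%E; last exact: fE.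
have H A : measurable A -> (\int[P]_(x in e @^-1` A) (1 : R)%:E =
    \int[mu]_(x in id @^-1` A) (1 : R)%:E)%E.
  by move=> mA; rewrite (integral_one mu) // (integral_one _ (mpre _ mA)); exact/esym/muE.
rewrite integral_mkcond [RHS]integral_mkcond.
have H2 := integral_change me (@measurable_id _ W setT) m1T
  m1W c0 (fun=> ler01) (g := f \_ S) H.
transitivity (\int[mu]_x ((f \_ S) x * (1)%:E))%E.
  by apply: eq_integral => x _; rewrite mule1.
rewrite -H2.
- apply: eq_integral => x _; rewrite mule1 !patchE /=.
  rewrite (_ : (x \in e @^-1` S) = (e x \in S)); last first.
    by apply/idP/idP; rewrite !inE.
  by case: ifP => // _; rewrite fineK.
- by apply/(measurable_restrictT _ _).1 => //; exact: measurable_funTS.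
- by apply: erestrict_ge0 => x _.
Qed.

Section disintegration.
Context d d1 d2 (T : measurableType d) (W : measurableType d1)
  (X : measurableType d2) (R : realType) (P : probability T R).
Variables (e : T -> W) (k : R.-pker W ~> X).

(** The law of [(e x, z)] when [x] follows [P] and [z] is drawn from [k (e x)]. *)
Definition kernel_joint (me : measurable_fun setT e) (S : set (W * X)) : \bar R :=
  (\int[P]_x k (e x) (xsection S (e x)))%E.
Hypothesis me : measurable_fun setT e.

Let mk S : measurable S -> measurable_fun setT (fun x => k (e x) (xsection S (e x))).
Proof.
move=> /mem_set mS.
exact: (measurableT_comp (measurable_fun_xsection_finite_kernel k mS) me).
Qed.
Let j0 : kernel_joint me set0 = 0%E.
Proof. by apply: integral0_eq => x _; rewrite xsection0 measure0. Qed.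
Let jge0 S : (0 <= kernel_joint me S)%E.
Proof. exact: integral_ge0. Qed.
Let jsigma : semi_sigma_additive (kernel_joint me).
Proof.
move=> F mF tF mUF.
have -> : kernel_joint me (\bigcup_n F n) = (\sum_(n <oo) kernel_joint me (F n))%E.
  rewrite /kernel_joint -integral_nneseries //; last by move=> n; exact: mk.
  apply: eq_integral => x _; rewrite xsection_bigcup.
  rewrite measure_bigcup //.
  - by apply: eq_eseriesl => n; rewrite in_setT.
  - by move=> n _; exact: measurable_xsection.
  - exact: trivIset_xsection.
by apply: is_cvg_ereal_nneg_natsum => n _.
Qed.
HB.instance Definition _ := isMeasure.Build _ _ _ (kernel_joint me) j0 jge0 jsigma.

Variable y : T -> X.
Hypothesis my : measurable_fun setT y.
Hypothesis law : forall A B, measurable A -> measurable B ->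
  P (e @^-1` A `&` y @^-1` B) = (\int[P]_(x in e @^-1` A) k (e x) B)%E.

Let ey x := (e x, y x).
Let mey : measurable_fun setT ey.
Proof. exact: measurable_fun_pair. Qed.
Let law_ey S : measurable S -> P (ey @^-1` S) = kernel_joint me S.
Proof.
move=> mS.
apply: (@measure_unique _ _ _ [set A `*` B | A in measurable & B in measurable]
  (fun=> setT) _ _ _ _ (pushforward P ey) (kernel_joint me)) => //.
- exact: measurable_prod_measurableType.
- move=> _ _ [A mA [B mB <-]] [A' mA' [B' mB' <-]].
  exists (A `&` A'); first exact: measurableI.
  by exists (B `&` B'); [exact: measurableI|rewrite setXI].
- by move=> _; exists setT => //; exists setT => //; rewrite setXTT.
- by apply/seteqP; split => // x _; exists 0%N.
- move=> _ [A mA [B mB <-]]; transitivity (P (e @^-1` A `&` y @^-1` B)) => //.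
  rewrite law // /kernel_joint.
  rewrite integral_mkcond; apply: eq_integral => x _; rewrite patchE.
  rewrite (_ : (x \in e @^-1` A) = (e x \in A)); last by apply/idP/idP; rewrite !inE.
  case: ifPn => H; first by rewrite in_xsectionX.
  by rewrite notin_xsectionX // measure0.
- move=> _; have := fin_num_measure P _ (preimage_measurable mey measurableT).
  by rewrite ge0_fin_numE.
Qed.

(** By [law], the law of [(e, y)] and [kernel_joint] agree on rectangles, hence on all measurable
    sets. This is the case of indicators; the rest is induction on nonnegative functions. *)
Lemma disintegration (F : W * X -> \bar R) : measurable_fun setT F ->
  (forall z, 0 <= F z)%E ->
  (\int[P]_x F (e x, y x) = \int[P]_x \int[k (e x)]_z F (e x, z))%E.
Proof.
have mS (f : W * X -> \bar R) (w : W) : measurable_fun setT f ->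
    measurable_fun setT (fun z => f (w, z)).
  by move=> mf; apply: (measurableT_comp mf); exact: pair1_measurable.
have mI (f : W * X -> \bar R) : measurable_fun setT f -> (forall z, 0 <= f z)%E ->
    measurable_fun setT (fun x => \int[k (e x)]_z f (e x, z))%E.
  move=> mf f0.
  exact: (measurableT_comp (measurable_fun_integral_finite_kernel f k f0 mf) me).
have mC (f : W * X -> \bar R) : measurable_fun setT f ->
    measurable_fun setT (fun x => f (e x, y x)).
  by move=> mf; apply: (measurableT_comp mf).
move: F; apply: nonneg_measurable_ind.
- move=> A mA.
  transitivity (\int[P]_x (\1_(ey @^-1` A) x)%:E)%E.
    by apply: eq_integral => x _; rewrite /= !indicE.
  rewrite integral_indic //; last exact: preimage_measurable.
  rewrite setIT; transitivity (kernel_joint me A); first exact: law_ey.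
  rewrite /kernel_joint; apply: eq_integral => x _.
  have mAx := measurable_xsection (e x) mA.
  rewrite -[xsection A (e x)]setIT -integral_indic //.
  by apply: eq_integral => z _ /=; rewrite !indicE mem_xsection.
- move=> r f r0 mf f0 IH.
  rewrite ge0_integralZl_EFin // ?IH; [|exact: mC].
  rewrite -ge0_integralZl_EFin //; [|by move=> x _; exact: integral_ge0|exact: mI].
  apply: eq_integral => x _; rewrite ge0_integralZl_EFin //; exact: mS.
- move=> f g mf mg f0 g0 IHf IHg.
  rewrite ge0_integralD ?IHf ?IHg //; [|exact: mC|exact: mC].
  rewrite -ge0_integralD //;
    [|by move=> x _; exact: integral_ge0|exact: mI|by move=> x _; exact: integral_ge0|exact: mI].
  apply: eq_integral => x _; rewrite ge0_integralD //; exact: mS.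
- move=> f_ mf f0 ndf IH.
  rewrite monotone_convergence //; last by move=> n; exact: mC.
  rewrite (_ : (fun n => _) = fun n => \int[P]_x \int[k (e x)]_z f_ n (e x, z))%E; last first.
    by apply/funext => n; exact: IH.
  rewrite -monotone_convergence //; last 3 first.
  - by move=> n; exact: mI.
  - by move=> n x _; exact: integral_ge0.
  - move=> x _ a b ab; apply: ge0_le_integral => //; try exact: mS.
    by move=> z _; exact: ndf.
  apply: eq_integral => x _; rewrite -monotone_convergence //.
  by move=> n; exact: mS.
Qed.
End disintegration.

(** * Total variation *)

Section nonmeasurable_integral.
Context d (T : measurableType d) (R : realType) (P : {measure set T -> \bar R}).
Import HBNNSimple.

(** A simple function below [F], once set to 0 on [N], lies below [G] and keeps its integral. *)
Lemma le_integral_off_null (F G : T -> \bar R) (N : set T) :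
  measurable N -> P N = 0%E -> (forall x, 0 <= F x)%E -> (forall x, 0 <= G x)%E ->
  (forall x, ~ N x -> F x = G x) -> (\int[P]_x F x <= \int[P]_x G x)%E.
Proof.
move=> mN PN F0 G0 FG; rewrite !ge0_integralTE //.
apply: ge_ereal_sup => _ [h hF <-].
have mNC := measurableC mN.
pose h' := proj_nnsfun h mNC.
have h'E x : h' x = h x * \1_(~` N) x by [].
apply: (@le_trans _ _ (sintegral P h')).
  rewrite -!integralT_nnsfun.
  rewrite (@ge0_negligible_integral _ _ _ P setT N) //; last 2 first.
  - exact/measurable_EFinP.
  - by move=> x _; rewrite lee_fin.
  rewrite [leRHS](@ge0_negligible_integral _ _ _ P setT N) //; last 2 first.
  - exact/measurable_EFinP.
  - by move=> x _; rewrite lee_fin.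
  rewrite le_eqVlt; apply/orP; left; apply/eqP/eq_integral => x /set_mem[_ Nx].
  by rewrite h'E indicE mem_set // mulr1.
apply: ereal_sup_ubound; exists h' => // x; rewrite -[X in (X%:E <= _)%E]/(h' x).
rewrite h'E indicE; have [Nx|Nx] := pselect (N x).
  by rewrite memNset ?mulr0 //; move=> /(_ Nx).
by rewrite mem_set // mulr1 -FG.
Qed.

(* No measurability of F or G is required: the integral of a nonnegative function
   is a supremum over the simple functions below it. *)
Lemma eq_integral_off_null (F G : T -> \bar R) (N : set T) :
  measurable N -> P N = 0%E -> (forall x, 0 <= F x)%E -> (forall x, 0 <= G x)%E ->
  (forall x, ~ N x -> F x = G x) -> (\int[P]_x F x = \int[P]_x G x)%E.
Proof.
move=> mN PN F0 G0 FG; apply/eqP; rewrite eq_le.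
by rewrite !(@le_integral_off_null _ _ N) // => x Nx; rewrite FG.
Qed.
End nonmeasurable_integral.

Lemma bounded_probability_integrable d (T : measurableType d) (R : realType)
  (P : probability T R) (g : T -> R) (M : R) : measurable_fun setT g ->
  (forall x, `|g x| <= M) -> P.-integrable setT (EFin \o g).
Proof.
move=> mg gM; apply: measurable_bounded_integrable => //.
- by rewrite -ge0_fin_numE // fin_num_measure.
- exists M; split; first exact: num_real.
  by move=> N MN x _ /=; apply: le_trans (gM x) (ltW MN).
Qed.

Lemma integral_probability_cst d (T : measurableType d) (R : realType)
  (P : probability T R) (a : R) : (\int[P]_x a%:E = a%:E)%E.
Proof.
rewrite integral_cst // [X in (_ * X)%E](_ : _ = 1%E) ?mule1 //.
exact: probability_setT.
Qed.

Section total_variation.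
Context d (X : measurableType d) (R : realType) (k' k : probability X R).
Variables (a : R) (f : X -> R).
Hypotheses (a_gt0 : 0 < a) (mf : measurable_fun setT f) (f_ge0 : forall x, 0 <= f x).
Hypothesis dens : forall B, measurable B ->
  (\int[k']_(x in B) a%:E = \int[k]_(x in B) (f x)%:E)%E.

Let fE : (\int[k]_x (f x)%:E = a%:E)%E.
Proof. by rewrite -dens // integral_probability_cst. Qed.

Let intf : k.-integrable setT (EFin \o f).
Proof.
apply/integrableP; split; first exact/measurable_EFinP.
under eq_integral do rewrite gee0_abs ?lee_fin //.
by rewrite fE ltry.
Qed.

Let integral_diff (g : X -> R) : measurable_fun setT g -> (forall x, `|g x| <= 1) ->
  (a%:E * (\int[k']_x (g x)%:E - \int[k]_x (g x)%:E) =
   \int[k]_x (g x * (f x - a))%:E)%E.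
Proof.
move=> mg g1.
have ig' := bounded_probability_integrable k' mg g1.
have ig := bounded_probability_integrable k mg g1.
have igf : k.-integrable setT (EFin \o (fun x => g x * f x)).
  apply: (integrableMr measurableT mg _ intf).
  exists 1; split; first exact: num_real.
  by move=> N MN x _ /=; apply: le_trans (g1 x) (ltW MN).
have iga : k.-integrable setT (EFin \o (fun x => a * g x)).
  exact: (integrableZl measurableT a ig).
have iga' : k'.-integrable setT (EFin \o (fun x => a * g x)).
  exact: (integrableZl measurableT a ig').
have ia : k'.-integrable setT (EFin \o (fun=> a : R)).
  exact: (bounded_probability_integrable _ (M := `|a|)).
(* [integral_change] takes nonnegative integrands only, hence the shift by 1. It adds the total mass
   [a] to both sides and is cancelled below. *)
have key : (\int[k']_x ((g x + 1)%:E * a%:E) = \int[k]_x ((g x + 1)%:E * (f x)%:E))%E.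
  apply: (@integral_change _ _ _ X X X R k' k id id (fun=> a) f _ _ _ _ _ _
    (fun x => (g x + 1)%:E)) => //.
  - by move=> _; exact: ltW.
  - exact/measurable_EFinP/measurable_funD.
  - by move=> x; rewrite lee_fin; have := g1 x; rewrite ler_norml => /andP[]; lra.
have {key} : (\int[k']_x (a * g x)%:E + a%:E = \int[k]_x (g x * f x)%:E + a%:E)%E.
  rewrite -{2}fE -(@integralD_EFin _ _ _ k setT measurableT (fun x => g x * f x) f) //.
  transitivity (\int[k']_x ((a * g x)%:E + a%:E))%E.
    rewrite (@integralD_EFin _ _ _ k' setT measurableT (fun x => a * g x) (fun=> a)) //.
    by rewrite integral_probability_cst.
  transitivity (\int[k']_x ((g x + 1)%:E * a%:E))%E.
    by apply: eq_integral => x _; rewrite -EFinM -EFinD; congr EFin; ring.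
  rewrite key; apply: eq_integral => x _.
  by rewrite -EFinM -EFinD; congr EFin; ring.
move=> /(congr1 (fun z => z - a%:E)%E); rewrite !addeK // => key.
have fin' : (\int[k']_x (g x)%:E)%E \is a fin_num by exact: integrable_fin_num.
have fin : (\int[k]_x (g x)%:E)%E \is a fin_num by exact: integrable_fin_num.
rewrite muleBr //; last by rewrite fin_num_adde_defl // fin_numN.
rewrite -(integralZl measurableT ig') // -(integralZl measurableT ig) //.
under eq_integral do rewrite /= -EFinM; rewrite key.
under [X in (_ - X)%E]eq_integral do rewrite /= -EFinM.
rewrite -(@integralB_EFin _ _ _ k setT (fun x => g x * f x) (fun x => a * g x)) //.
by apply: eq_integral => x _; rewrite -EFinB; congr EFin; ring.
Qed.

(** Multiplied by [a], the difference of the integrals of [g] is the [k]-integral of g (f - a). Over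
    |g| <= 1 this is largest for [g] the sign of f - a. *)
Lemma TV_density : TV k' k = ((a^-1)%:E * \int[k]_x `|f x - a|%:E)%E.
Proof.
have mfa : measurable_fun setT (fun x => f x - a) by exact: measurable_funB.
have diffE (g : X -> R) : measurable_fun setT g -> (forall x, `|g x| <= 1) ->
    (`| \int[k']_x (g x)%:E - \int[k]_x (g x)%:E | =
     (a^-1)%:E * `| \int[k]_x (g x * (f x - a))%:E |)%E.
  move=> mg g1; rewrite -integral_diff // abseM muleA /= -EFinM.
  by rewrite gtr0_norm // mulVf ?gt_eqF // mul1e.
have a0 : (0 <= (a^-1)%:E)%E by rewrite lee_fin invr_ge0 ltW.
apply/eqP; rewrite eq_le; apply/andP; split.
  apply: ge_ereal_sup => _ [g [mg g1] <-]; rewrite diffE //.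
  apply: lee_wpmul2l => //.
  apply: le_trans (le_abse_integral _ _ _) _ => //.
    exact/measurable_EFinP/measurable_funM.
  apply: ge0_le_integral => //.
  - by apply/measurable_EFinP/measurableT_comp => //; exact: measurable_funM.
  - by apply/measurable_EFinP/measurableT_comp.
  - by move=> x _; rewrite lee_fin normrM ler_piMl.
pose g x : R := if 0 <= f x - a then 1 else -1.
have mg : measurable_fun setT g.
  apply: measurable_fun_ifT => //.
  exact: measurable_fun_ler.
have g1 x : `|g x| <= 1 by rewrite /g; case: ifP; rewrite ?normrN normr1.
apply: ereal_sup_ubound; exists g => //=.
rewrite diffE // (_ : (fun x => (g x * (f x - a))%:E) = fun x => `|f x - a|%:E).
  by rewrite gee0_abs //; apply: integral_ge0 => x _; rewrite lee_fin.
apply/funext => x; congr EFin; rewrite /g; case: ifPn => H.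
  by rewrite mul1r ger0_norm.
by rewrite mulN1r ltr0_norm // ltNge.
Qed.

End total_variation.

Lemma TV_ge0 d (X : measurableType d) (R : realType) (p q : probability X R) :
  (0 <= TV p q)%E.
Proof.
apply: ereal_sup_ge; exists `| \int[p]_x 0%:E - \int[q]_x 0%:E |%E => //.
by exists (fun=> 0 : R) => //; split => // x; rewrite normr0.
Qed.

(** * Countable generators and Bayes' rule for conditional laws *)

(** The generators are the finite intersections of balls of radius 1/(m+1) centred in a countable
    dense set. Intersections are included to obtain a pi-system. *)
Lemma polish_countable_generator (R : realType) d (X : measurableType d) :
  polish_measurable R X -> exists I : nat -> set X,
    [/\ @measurable _ X = <<s range I >>, setI_closed (range I) & range I setT].
Proof.
move=> [dist [[d0 d_eq0 dC d_tri] [_ [D [/countable_injP[j jinj] Dd]] ->]]].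
(* A ball is coded by the number of its centre under the injection [j] and by [m]; the code gives
   the empty set if no centre has that number. *)
pose C (k : nat * nat) :=
  [set x : X | exists y, [/\ D y, j y = k.1 & dist y x < k.2.+1%:R^-1]].
(* A finite intersection is coded by a list of balls. The empty list gives [setT], and concatenating
   lists intersects the sets. *)
pose I n := if (choice.unpickle n : option (seq (nat * nat))) is Some s
  then [set x | forall k, k \in s -> C k x] else setT.
have IP (s : seq (nat * nat)) : I (choice.pickle s) = [set x | forall k, k \in s -> C k x].
  by rewrite /I choice.pickleK.
have IT : I (choice.pickle ([::] : seq (nat * nat))) = setT.
  by rewrite IP; apply/seteqP; split.
have rI n : exists s, I n = I (choice.pickle (s : seq (nat * nat))).
  rewrite {1}/I; case: choice.unpickle => [s|]; first by exists s; rewrite IP.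
  by exists [::].
exists I; split; last by exists (choice.pickle ([::] : seq (nat * nat))).
  set O := [set U | _]; rewrite -/O.
  have Copen k : O (C k).
    move=> x [y [Dy jy yx]]; exists (k.2.+1%:R^-1 - dist y x).
      by rewrite subr_gt0.
    move=> z /= xz; exists y; split => //.
    by apply: le_lt_trans (d_tri _ x _) _; rewrite -ltrBrDl.
  apply/seteqP; split.
    apply: smallest_sub; first exact: smallest_sigma_algebra.
    move=> U UO.
    (* An open set is the union of the coded balls that it contains. Around a point, a centre and a
       radius both below [eps / 2] keep the ball within distance [eps]. *)
    pose V n := if (choice.unpickle n : option (nat * nat)) is Some k then
      (if pselect (C k `<=` U) then C k else set0) else set0.
    have -> : U = \bigcup_n V n.
      apply/seteqP; split => [x Ux|x [n _]]; last first.
        rewrite /V; case: choice.unpickle => [k|//]; case: pselect => // CU.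
        exact: CU.
      have [eps eps0 epsU] := UO x Ux.
      have eps2 : 0 < eps / 2 by rewrite divr_gt0.
      have [m _ /(_ m (leqnn m)) /= mN] := near_infty_natSinv_lt (PosNum eps2).
      have m0 : 0 < m.+1%:R^-1 :> R by rewrite invr_gt0 ltr0Sn.
      have [y Dy xy] := Dd x _ m0.
      exists (choice.pickle (j y, m)) => //; rewrite /V choice.pickleK.
      have Cx : C (j y, m) x by exists y; split => //=; rewrite dC.
      case: pselect => [//|nCU]; exfalso; apply: nCU => z /= [y' [Dy' jy' zy']].
      have yy' : y' = y by apply: jinj => //; rewrite inE.
      apply: epsU => /=; apply: le_lt_trans (d_tri _ y _) _.
      rewrite yy' in zy'; have {}mN : m.+1%:R^-1 < eps / 2 := mN.
      have := lt_trans xy mN; have := lt_trans zy' mN; lra.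
    apply: (@bigcup_measurable _ (g_sigma_algebraType (range I))) => n _.
    rewrite /V; case: choice.unpickle => [k|]; last exact: (@measurable0 _ (g_sigma_algebraType (range I))).
    case: pselect => [CU|nCU]; last exact: (@measurable0 _ (g_sigma_algebraType (range I))).
    apply: sub_sigma_algebra; exists (choice.pickle [:: k]) => //.
    rewrite IP; apply/seteqP; split => x /=.
      by move=> H; apply: H; rewrite mem_head.
    by move=> Cx k'; rewrite mem_seq1 => /eqP ->.
  apply: smallest_sub; first exact: smallest_sigma_algebra.
  move=> _ [n _ <-]; have [s ->] := rI n; elim: s => [|k s IH].
    by rewrite IT; exact: (@measurableT _ (g_sigma_algebraType O)).
  rewrite (_ : I _ = C k `&` I (choice.pickle s)).
    apply: (@measurableI _ (g_sigma_algebraType O)) => //.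
    by apply: sub_sigma_algebra; exact: Copen.
  rewrite !IP; apply/seteqP; split => x /=.
    move=> H; split; first by apply: H; rewrite mem_head.
    by move=> k' ks; apply: H; rewrite in_cons ks orbT.
  by move=> [Ck Hs] k'; rewrite in_cons => /orP[/eqP -> //|]; exact: Hs.
move=> _ _ [m _ <-] [n _ <-].
have [s ->] := rI m; have [t ->] := rI n.
exists (choice.pickle (s ++ t)) => //; rewrite !IP; apply/seteqP; split => x /=.
  by move=> H; split => k ks; apply: H; rewrite mem_cat ks ?orbT.
by move=> [Hs Ht] k; rewrite mem_cat => /orP[/Hs|/Ht].
Qed.

(** The sigma-algebra on probability measures is generated by evaluations at sets. With
    [kprobability], a setwise measurable family thus becomes a kernel. *)
Lemma measurable_probability_map d d' (W : measurableType d) (X : measurableType d')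
  (R : realType) (k : W -> probability X R) :
  (forall B, measurable B -> measurable_fun setT (fun w => k w B)) ->
  measurable_fun setT (k : W -> pprobability X R).
Proof.
move=> mk; apply: (measurability (@pset _ X R : set (set (pprobability X R)))) => //.
move=> _ [_ [r _ [U mU <-]] <-]; rewrite setTI.
rewrite (_ : k @^-1` _ = (fun w => k w U) @^-1` `]-oo, r%:E[%classic).
  exact: (preimage_measurable (mk U mU) (emeasurable_itv _)).
by apply/seteqP; split => w /=; rewrite in_itv.
Qed.

Section total_variation_of_conditional_laws.
Context (R : realType) dX dO (X : measurableType dX) (O : measurableType dO).
Variables (G : set (set O)) (Y : O -> X) (P' P : probability O R).
Variables (k' k : O -> probability X R).
Local Notation W := (g_sigma_algebraType G).
Hypotheses (GO : G `<=` measurable) (mY : measurable_fun setT Y).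
Hypotheses (law' : is_cond_dist P' <<s G>> Y k') (law : is_cond_dist P <<s G>> Y k).
Variables (phi : W * X -> R) (a : W -> R).
Hypotheses (mphi : measurable_fun setT phi) (phi_ge0 : forall z, 0 <= phi z).
Hypotheses (ma : measurable_fun setT a) (a_ge0 : forall w, 0 <= a w).
Hypothesis phi_dens : forall S : set (W * X), measurable S ->
  P' ((fun w => (w, Y w)) @^-1` S) =
  (\int[P]_(w in (fun w => (w, Y w)) @^-1` S) (phi (w, Y w))%:E)%E.
Hypothesis a_dens : forall A : set W, measurable A ->
  P' A = (\int[P]_(w in A) (a w)%:E)%E.
Hypothesis X_gen : exists I : nat -> set X,
  [/\ @measurable _ X = <<s range I>>, setI_closed (range I) & range I setT].

Let e : O -> W := id.
Let me : measurable_fun setT e.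
Proof.
move=> _ A mA; rewrite setTI.
exact: (smallest_sub (@sigma_algebra_measurable _ O) GO).
Qed.
Let mW (A : set W) : measurable A -> @measurable _ O A.
Proof. exact: (preimage_measurable me). Qed.

Let mk' B : measurable B -> measurable_fun setT (fun w : W => k' w B).
Proof. by move=> mB _ V mV; rewrite setTI; exact: (law'.1 _ mB _ mV). Qed.
Let mk B : measurable B -> measurable_fun setT (fun w : W => k w B).
Proof. by move=> mB _ V mV; rewrite setTI; exact: (law.1 _ mB _ mV). Qed.

Let K : R.-pker W ~> X := kprobability (measurable_probability_map mk).
Let disint (F : W * X -> \bar R) : measurable_fun setT F -> (forall z, 0 <= F z)%E ->
  (\int[P]_w F (w, Y w) = \int[P]_w \int[k w]_z F (w, z))%E.
Proof.
move=> mF F0; apply: (@disintegration _ _ _ O W X R P e K me Y mY _ F mF F0).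
by move=> A B mA mB; exact: law.2.
Qed.
Let mint (F : W * X -> \bar R) : measurable_fun setT F -> (forall z, 0 <= F z)%E ->
  measurable_fun setT (fun w : W => \int[k w]_z F (w, z))%E.
Proof. by move=> mF F0; exact: (measurable_fun_integral_finite_kernel F K). Qed.

Let change (g : W -> \bar R) : measurable_fun setT g -> (forall w, 0 <= g w)%E ->
  (\int[P']_w g w = \int[P]_w (g w * (a w)%:E))%E.
Proof.
move=> mg g0.
transitivity (\int[P']_w (g w * 1%:E))%E.
  by apply: eq_integral => w _; rewrite mule1.
apply: (@integral_change _ _ _ O O W R P' P e e (fun=> 1) a) => //.
- exact: (measurableT_comp ma me).
- move=> A mA; rewrite -a_dens // integral_one //; exact: mW.
Qed.

(** [L] and [Rt] are the two sides of Bayes' rule on the set [B]. *)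
Let L B w : \bar R := (k' w B * (a w)%:E)%E.
Let Rt B w : \bar R := (\int[k w]_(z in B) (phi (w, z))%:E)%E.

Let mL B : measurable B -> measurable_fun setT (L B : W -> \bar R).
Proof. by move=> mB; apply: emeasurable_funM; [exact: mk'|exact/measurable_EFinP]. Qed.
Let L0 B w : (0 <= L B w)%E.
Proof. by rewrite mule_ge0 // lee_fin. Qed.
Let R0 B w : (0 <= Rt B w)%E.
Proof. by apply: integral_ge0 => z _; rewrite lee_fin. Qed.

Let FB B (z : W * X) : \bar R := ((\1_B z.2)%:E * (phi z)%:E)%E.
Let mFB B : measurable B -> measurable_fun setT (FB B).
Proof.
move=> mB; apply: emeasurable_funM; apply/measurable_EFinP => //.
exact: (measurableT_comp (measurable_indic mB) measurable_snd).
Qed.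
Let FB0 B z : (0 <= FB B z)%E.
Proof. by rewrite mule_ge0 // lee_fin. Qed.
Let RtE B w : Rt B w = (\int[k w]_z FB B (w, z))%E.
Proof.
rewrite /Rt integral_mkcond; apply: eq_integral => z _.
by rewrite /FB patchE indicE /=; case: ifP; rewrite ?mul1e ?mul0e.
Qed.
Let mR B : measurable B -> measurable_fun setT (Rt B : W -> \bar R).
Proof.
move=> mB; rewrite (_ : Rt B = fun w => \int[k w]_z FB B (w, z))%E.
  by apply: mint => //; exact: mFB.
by apply/funext => w; exact: RtE.
Qed.

Let intL A B : @measurable _ W A -> measurable B ->
  (\int[P]_(w in A) L B w = P' (A `&` Y @^-1` B))%E.
Proof.
move=> mA mB; rewrite law'.2 // integral_mkcond [RHS]integral_mkcond.
rewrite (change (g := (fun w => k' w B) \_ A)).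
- apply: eq_integral => w _; rewrite !patchE; case: ifP => //.
  by rewrite mul0e.
- by apply/(measurable_restrictT _ _).1 => //; apply: measurable_funTS; exact: mk'.
- by apply: erestrict_ge0.
Qed.

Let intR A B : @measurable _ W A -> measurable B ->
  (\int[P]_(w in A) Rt B w = P' (A `&` Y @^-1` B))%E.
Proof.
move=> mA mB.
rewrite (_ : A `&` Y @^-1` B = (fun w => (w, Y w)) @^-1` (A `*` B)) //.
rewrite phi_dens; last exact: measurableX.
pose F (z : W * X) := ((\1_(A `*` B) z)%:E * (phi z)%:E)%E.
have mF : measurable_fun setT F.
  apply: emeasurable_funM; apply/measurable_EFinP => //.
  by apply: measurable_indic; exact: measurableX.
have F0 z : (0 <= F z)%E by rewrite mule_ge0 // lee_fin.
transitivity (\int[P]_w F (w, Y w))%E; last first.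
  exact/esym/(integral_setI_weight P (fun w => (w, Y w) : W * X) (fun w => phi (w, Y w))).
rewrite disint // integral_mkcond; apply: eq_integral => w _.
rewrite patchE; case: ifPn => wA.
  rewrite RtE; apply: eq_integral => z _; rewrite /F /FB !indicE; congr (_%:R%:E * _)%E.
  congr nat_of_bool; apply/idP/idP => /set_mem /=.
    by move=> zB; apply/mem_set; split => //; exact: set_mem.
  by move=> [_ zB]; apply/mem_set.
apply/esym/integral0_eq => z _; rewrite /F indicE memNset ?mul0e // => -[/= wA' _].
by move: wA; rewrite mem_set.
Qed.

(** By [intL] and [intR], both sides are [W]-measurable and have the integral P'(A and Y in B) over
    every [A] of [W], so they agree almost surely. *)
Let null_of B : measurable B -> exists N : set W,
  [/\ @measurable _ W N, P N = 0%E & forall w, ~ N w -> L B w = Rt B w].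
Proof.
move=> mB.
(* The restriction of [P] to [W]: working with it places the exceptional set in the smaller
   sigma-algebra. *)
pose m0 : {measure set W -> \bar R} := pushforward P e.
pose m := m0 me.
have mE (g : W -> \bar R) A : measurable A -> measurable_fun setT g ->
    (forall w, 0 <= g w)%E -> (\int[m]_(w in A) g w = \int[P]_(w in A) g w)%E.
  move=> mA mg g0.
  rewrite (ge0_integral_pushforward me) //; exact: measurable_funTS.
have : ae_eq m setT (L B : W -> \bar R) (Rt B : W -> \bar R).
  apply: integral_ae_eq => //.
  - apply/integrableP; split; first exact: mL.
    under eq_integral do rewrite gee0_abs //.
    rewrite mE //; last exact: mL.
    rewrite intL // setTI -ge0_fin_numE //; apply: fin_num_measure.
    exact: preimage_measurable.
  - exact: mR.
  - move=> A _ mA; rewrite mE //; last exact: mL.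
    rewrite mE //; last exact: mR.
    by rewrite intL // intR.
move=> [N [mN PN sN]]; exists N; split => //.
move=> w Nw; apply: contrapT => nE; apply: Nw; apply: sN => /= H; apply: nE.
exact: H.
Qed.

(** Off the union of the null sets of the generators, Bayes' rule holds for all measurable sets by
    uniqueness on a pi-system, and [TV_density] evaluates the distance. Passing from [P'] to [P]
    brings in the factor [a w], and [disint] turns the inner integral over [k w] into evaluation at
    [Y w]. *)
Lemma integral_TV :
  (\int[P']_w TV (k' w) (k w) = \int[P]_w `|phi (w, Y w) - a w|%:E)%E.
Proof.
have [I [XI II IT]] := X_gen.
have mI n : measurable (I n) by rewrite XI; apply: sub_sigma_algebra; exists n.
have /choice[N HN] n := null_of (mI n).
pose N' := \bigcup_n N n.
have mN' : @measurable _ W N' by apply: bigcup_measurable => n _; have [] := HN n.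
have PN' : P N' = 0%E.
  apply/negligibleP; first exact: mW.
  apply: negligible_bigcup => n; have [mN PN _] := HN n.
  by apply/negligibleP => //; exact: mW.
have P'N' : P' N' = 0%E.
  rewrite a_dens // (ge0_negligible_integral (mW mN') (mW mN') _ _ PN').
  - by rewrite setDv integral_set0.
  - by apply/measurable_funTS/measurable_EFinP; exact: (measurableT_comp ma me).
  - by move=> w _; rewrite lee_fin.
(* Here the division by [a] fails. The set is null for [P'], whose density on [W] is [a], but [P]
   may charge it. *)
pose N0 : set W := a @^-1` [set 0].
have mN0 : measurable N0 by exact: preimage_measurable.
have P'N0 : P' N0 = 0%E.
  by rewrite a_dens //; apply: integral0_eq => w /= ->.
pose F (z : W * X) : \bar R := `|phi z - a z.1|%:E.
have mF : measurable_fun setT F.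
  apply/measurable_EFinP/measurableT_comp => //; apply: measurable_funB => //.
  exact: (measurableT_comp ma measurable_fst).
have F0 z : (0 <= F z)%E by rewrite lee_fin.
pose J w := (\int[k w]_z F (w, z))%E.
have J0 w : (0 <= J w)%E by exact: integral_ge0.
have mJ : measurable_fun setT (J : W -> \bar R) by exact: mint.
pose g w := ((a w)^-1%:E * J w)%E.
have mg : measurable_fun setT (g : W -> \bar R).
  apply: emeasurable_funM => //; apply/measurable_EFinP.
  (* Measurability of the inverse comes from that of powers; at 0 both take the value 0. *)
  rewrite (_ : (fun w => (a w)^-1) = fun w => powR (a w) (-1)).
    exact: (measurableT_comp (measurable_powR _) ma).
  by apply/funext => w; rewrite powR_inv1.
have g0 w : (0 <= g w)%E by rewrite mule_ge0 // lee_fin invr_ge0.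
rewrite (@eq_integral_off_null _ _ _ P' _ g (N' `|` N0)) //; first last.
- move=> w; rewrite not_orE => -[N'w N0w].
  have aw : 0 < a w by rewrite lt0r a_ge0 andbT; apply/eqP.
  have mphiw : measurable_fun setT (fun z => phi (w, z)).
    by apply: (measurableT_comp mphi); exact: pair1_measurable.
  apply: (@TV_density _ X R (k' w) (k w) (a w) (fun z => phi (w, z))) => //.
  move=> B; rewrite XI => mB.
  apply: (@weighted_pi_unique _ X R (k' w) (k w) (fun=> a w) (fun z => phi (w, z)) (range I)) => //.
  + by move=> _ [n _ <-].
  + by rewrite integral_probability_cst ltry.
  + move=> _ [n _ <-]; have [_ _ H] := HN n.
    rewrite integral_cst // muleC; apply: H => Nw; apply: N'w; by exists n.
- by move=> w; exact: TV_ge0.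
- apply/negligibleP; first by apply: measurableU; exact: mW.
  by apply: negligibleU; apply/negligibleP => //; exact: mW.
- by apply: measurableU; exact: mW.
rewrite change //.
rewrite (@eq_integral_off_null _ _ _ P _ J N') //.
- by rewrite -disint.
- exact: mW.
- by move=> w; rewrite mule_ge0 // lee_fin.
move=> w N'w.
(* Where [a] vanishes the left side is 0, and so is [J w]: Bayes' rule for the generator [setT] says
   that [phi (w, .)] has [k w]-integral [a w]. *)
have [aw|aw] := eqVneq (a w) 0; last first.
  by rewrite /g muleAC -EFinM mulVf // mul1e.
rewrite aw mule0; apply/esym.
have [n _ In] := IT; have [_ _ /(_ w)-HNn] := HN n.
have : Rt (I n) w = 0%E.
  by rewrite -HNn /L ?aw ?mule0 // => Nw; apply: N'w; exists n.
rewrite In /Rt => H0; rewrite -[RHS]H0; apply: eq_integral => z _.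
by rewrite /F /= aw subr0 ger0_norm.
Qed.

End total_variation_of_conditional_laws.

(** * Martingale increments *)

(** A version [b] obeys the bound [K] only almost surely, but c = min(b, K) is again a version. It
    is below [b]; conversely it equals [b] where b <= K, and elsewhere it equals [K], which is at
    least [D]. *)
Lemma bounded_conditional_expectation d d' (T : measurableType d)
  (W : measurableType d') (R : realType) (P : probability T R) (e : T -> W)
  (D : T -> R) (K : R) :
  measurable_fun setT e -> measurable_fun setT D -> (forall x, 0 <= D x <= K) ->
  exists b : W -> R, [/\ measurable_fun setT b, (forall w, 0 <= b w <= K) &
    forall S, measurable S -> (\int[P]_(x in e @^-1` S) (D x)%:E =
      \int[P]_(x in e @^-1` S) (b (e x))%:E)%E].
Proof.
move=> me mD D0K.
have D0 x : 0 <= D x by case/andP: (D0K x).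
have DK x : D x <= K by case/andP: (D0K x).
have K0 : 0 <= K := le_trans (D0 point) (DK point).
have fin : (\int[P]_x (D x)%:E < +oo)%E.
  apply: (@le_lt_trans _ _ (\int[P]_x K%:E)%E).
    apply: ge0_le_integral => //; last by move=> x _; rewrite lee_fin.
    - by move=> x _; rewrite lee_fin.
    - exact/measurable_EFinP.
  by rewrite integral_probability_cst ltry.
have [b [mb b0 bE]] := conditional_expectation me mD D0 fin.
pose c w := Num.min (b w) K.
have mc : measurable_fun setT c by exact: measurable_minr.
have c0 w : 0 <= c w by rewrite le_min b0.
have cb w : c w <= b w by rewrite ge_min lexx.
have cK w : c w <= K by rewrite ge_min lexx orbT.
exists c; split => // [w|S mS]; first by rewrite c0 cK.
have mbe : measurable_fun setT (b \o e) by exact: measurableT_comp.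
have mce : measurable_fun setT (c \o e) by exact: measurableT_comp.
have mE A (u : T -> R) : measurable_fun setT u -> measurable_fun A (EFin \o u).
  by move=> mu; apply/measurable_funTS/measurable_EFinP.
have mpre A : measurable A -> measurable (e @^-1` A) by exact: preimage_measurable.
apply/eqP; rewrite eq_le; apply/andP; split; last first.
  rewrite bE //; apply: ge0_le_integral => //.
  - exact: mpre.
  - by move=> x _; rewrite lee_fin.
  - exact: mE mce.
  - exact: mE mbe.
  - by move=> x _; rewrite lee_fin.
pose A : set W := [set w | b w <= K].
have mA : measurable A.
  rewrite (_ : A = b @^-1` `]-oo, K]%classic); first exact: preimage_measurable.
  by apply/seteqP; split => w /=; rewrite in_itv.
have SE : e @^-1` S = e @^-1` (S `&` A) `|` e @^-1` (S `\` A).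
  by rewrite -preimage_setU setUIDK.
have disj : [disjoint e @^-1` (S `&` A) & e @^-1` (S `\` A)].
  by apply/disj_setPS => x [[_ ?] []].
have mSA : measurable (S `&` A) by exact: measurableI.
have mSD : measurable (S `\` A) by exact: measurableD.
have split_int (u : T -> R) : measurable_fun setT u -> (forall x, 0 <= u x) ->
    (\int[P]_(x in e @^-1` S) (u x)%:E = \int[P]_(x in e @^-1` (S `&` A)) (u x)%:E +
      \int[P]_(x in e @^-1` (S `\` A)) (u x)%:E)%E.
  move=> mu u0; rewrite SE ge0_integral_setU //; [exact: mpre|exact: mpre|exact: mE mu|].
  by move=> x _; rewrite lee_fin.
rewrite (split_int _ mD D0) (split_int _ mce (fun x => c0 _)) bE //.
apply: leeD.
  apply: ge0_le_integral => //; [exact: mpre|..].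
  - by move=> x _; rewrite lee_fin.
  - exact: mE mbe.
  - exact: mE mce.
  - by move=> x [_ Ax]; rewrite lee_fin le_min lexx.
apply: ge0_le_integral => //; [exact: mpre|..].
- by move=> x _; rewrite lee_fin.
- exact: mE mD.
- exact: mE mce.
- move=> x [_ /negP]; rewrite -ltNge => Ax.
  by rewrite lee_fin /= /c (min_idPr (ltW Ax)).
Qed.

Lemma ge0_integrable d (T : measurableType d) (R : realType)
  (P : {measure set T -> \bar R}) (u : T -> R) : measurable_fun setT u ->
  (forall x, 0 <= u x) -> (\int[P]_x (u x)%:E < +oo)%E ->
  P.-integrable setT (EFin \o u).
Proof.
move=> mu u0 fin; apply/integrableP; split; first exact/measurable_EFinP.
by under eq_integral do rewrite gee0_abs ?lee_fin //.
Qed.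

(** On the event v <= u, which lies in the sigma-algebra of [G], the integral of |u - v| is that of
    u - v, hence that of U - V, hence at most that of |U - V|. The complement is treated with the
    roles exchanged. *)
Lemma conditional_expectation_contraction d (T : measurableType d) (R : realType)
  (P : {measure set T -> \bar R}) (G : set (set T)) (u v U V : T -> R) :
  G `<=` measurable ->
  P.-integrable setT (EFin \o u) -> P.-integrable setT (EFin \o v) ->
  P.-integrable setT (EFin \o U) -> P.-integrable setT (EFin \o V) ->
  measurable_fun setT (u : g_sigma_algebraType G -> R) ->
  measurable_fun setT (v : g_sigma_algebraType G -> R) ->
  (forall A, <<s G>> A -> \int[P]_(x in A) (u x)%:E = \int[P]_(x in A) (U x)%:E)%E ->
  (forall A, <<s G>> A -> \int[P]_(x in A) (v x)%:E = \int[P]_(x in A) (V x)%:E)%E ->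
  (\int[P]_x `|u x - v x|%:E <= \int[P]_x `|U x - V x|%:E)%E.
Proof.
move=> GO iu iv iU iV mu mv uU vV.
have mO : <<s G>> `<=` @measurable _ T.
  exact: (smallest_sub (@sigma_algebra_measurable _ T) GO).
pose A : set (g_sigma_algebraType G) := [set x | v x <= u x].
have mA : @measurable _ (g_sigma_algebraType G) A.
  rewrite (_ : A = (fun x => u x - v x) @^-1` `[0, +oo[%classic).
    by apply: preimage_measurable => //; exact: measurable_funB.
  by apply/seteqP; split => w /=; rewrite in_itv /= andbT subr_ge0.
have mAC : @measurable _ (g_sigma_algebraType G) (~` A) by exact: measurableC.
have sub (u' v' : T -> R) (B : set T) : measurable B ->
    P.-integrable setT (EFin \o u') -> P.-integrable setT (EFin \o v') ->
    (\int[P]_(x in B) (u' x - v' x)%:E =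
     \int[P]_(x in B) (u' x)%:E - \int[P]_(x in B) (v' x)%:E)%E.
  move=> mB iu' iv'; rewrite -(@integralB_EFin _ T R P B u' v') //.
  - exact: (integrableS measurableT).
  - exact: (integrableS measurableT).
have mAb (u' v' : T -> R) : P.-integrable setT (EFin \o u') ->
    P.-integrable setT (EFin \o v') -> measurable_fun setT (fun x => `|u' x - v' x|%:E).
  move=> /measurable_int/measurable_EFinP mu' /measurable_int/measurable_EFinP mv'.
  apply/measurable_EFinP/measurableT_comp => //; exact: measurable_funB.
have splitA (u' v' : T -> R) : P.-integrable setT (EFin \o u') ->
    P.-integrable setT (EFin \o v') ->
    (\int[P]_x `|u' x - v' x|%:E = \int[P]_(x in A) `|u' x - v' x|%:E +
     \int[P]_(x in ~` A) `|u' x - v' x|%:E)%E.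
  move=> iu' iv'; rewrite -(setUv A) ge0_integral_setU //.
  - exact: mO.
  - exact: mO.
  - by apply: measurable_funTS; exact: mAb.
  - exact/disj_setPCl.
have half (u' v' U' V' : T -> R) (B : set T) : measurable B ->
    P.-integrable setT (EFin \o u') -> P.-integrable setT (EFin \o v') ->
    P.-integrable setT (EFin \o U') -> P.-integrable setT (EFin \o V') ->
    (\int[P]_(x in B) (u' x)%:E = \int[P]_(x in B) (U' x)%:E)%E ->
    (\int[P]_(x in B) (v' x)%:E = \int[P]_(x in B) (V' x)%:E)%E ->
    (forall x, B x -> v' x <= u' x) ->
    (\int[P]_(x in B) `|u' x - v' x|%:E <= \int[P]_(x in B) `|U' x - V' x|%:E)%E.
  move=> mB iu' iv' iU' iV' uU' vV' vu.
  have -> : (\int[P]_(x in B) `|u' x - v' x|%:E = \int[P]_(x in B) (U' x - V' x)%:E)%E.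
    rewrite sub // -uU' -vV' -sub //.
    by apply: eq_integral => x /set_mem Bx; rewrite ger0_norm // subr_ge0; exact: vu.
  have iUV : P.-integrable B (EFin \o (fun x => U' x - V' x)).
    by apply: (integrableS measurableT) => //; exact: (integrableB measurableT iU' iV').
  apply: le_integral => //; first exact: (integrable_norm iUV).
  by move=> x _; rewrite lee_fin ler_norm.
rewrite splitA // splitA //; apply: leeD.
  by apply: half => //; [exact: mO|exact: uU|exact: vV].
under eq_integral do rewrite distrC; under [leRHS]eq_integral do rewrite distrC.
apply: half => //; [exact: mO|exact: vV|exact: uU|].
by move=> x /negP; rewrite -ltNge => /ltW.
Qed.

Lemma cvge0P (R : realType) (u : nat -> \bar R) : (forall n, 0 <= u n)%E ->
  (forall eps : R, 0 < eps -> exists N, forall n, (N <= n)%N -> (u n <= eps%:E)%E) ->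
  u @ \oo --> 0%E.
Proof.
move=> u0 H; apply/fine_cvgP; split.
  have [N HN] := H 1 ltr01; exists N => // n /= Nn.
  rewrite ge0_fin_numE //; exact: le_lt_trans (HN n Nn) (ltry _).
apply/cvgrPdist_le => eps eps0; have [N HN] := H eps eps0; exists N => // n /= Nn.
rewrite sub0r normrN ger0_norm; last exact: fine_ge0.
rewrite -lee_fin fineK ?HN // ge0_fin_numE //; exact: le_lt_trans (HN n Nn) (ltry _).
Qed.

(** Dominated convergence: the error is at most [D], and at [x] it is 0 once the level exceeds
    [D x]. *)
Lemma truncation_error d (T : measurableType d) (R : realType)
  (P : {measure set T -> \bar R}) (D : T -> R) : measurable_fun setT D ->
  (forall x, 0 <= D x) -> P.-integrable setT (EFin \o D) ->
  forall eps : R, 0 < eps -> exists K : nat,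
    (\int[P]_x `|D x - Num.min (D x) K%:R|%:E <= eps%:E)%E.
Proof.
move=> mD D0 iD eps eps0.
have mDK (K : nat) : measurable_fun setT (fun x => `|D x - Num.min (D x) K%:R|).
  apply: measurableT_comp => //; apply: measurable_funB => //.
  exact: measurable_minr.
have : (\int[P]_x `|D x - Num.min (D x) n%:R|%:E)%E @[n --> \oo] --> (\int[P]_x 0%E)%E.
  apply: (@dominated_cvg _ T R P setT measurableT
    (fun n x => `|D x - Num.min (D x) n%:R|%:E) (cst 0%E) (EFin \o D)) => //.
  - by move=> n; exact/measurable_EFinP.
  - move=> x _; apply: cvg_near_cst.
    apply: filterS (nbhs_infty_ger (D x)) => n Dn /=.
    by rewrite (min_idPl Dn) subrr normr0.
  - move=> n x _; rewrite /= lee_fin normr_id.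
    have m0 : 0 <= Num.min (D x) n%:R by rewrite le_min D0 ler0n.
    have mD' : Num.min (D x) n%:R <= D x by rewrite ge_min lexx.
    by rewrite ger0_norm ?subr_ge0 // lerBlDr lerDl.
rewrite integral0 => /fine_cvgP[[N1 _ H1] /cvgrPdist_le/(_ eps eps0)[N2 _ H2]].
exists (maxn N1 N2); rewrite -[leLHS]fineK; last by apply: H1; rewrite /= leq_maxl.
rewrite lee_fin; have := H2 (maxn N1 N2) (leq_maxr _ _).
rewrite /= sub0r normrN ger0_norm //; apply: fine_ge0; apply: integral_ge0 => x _.
by rewrite lee_fin.
Qed.

(** Stands in for the Cauchy-Schwarz inequality in passing from L^2 to L^1: either |t| <= s, or |t|
    <= t^2 / s. *)
Lemma norm_le_sqr (R : realFieldType) (s t : R) : 0 < s -> `|t| <= s + s^-1 * t ^+ 2.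
Proof.
move=> s0; rewrite -real_normK ?num_real //; set y := `|t|.
have y0 : 0 <= y by exact: normr_ge0.
have [ys|sy] := leP y s.
  by rewrite ler_wpDr // mulr_ge0 ?invr_ge0 ?sqr_ge0 // ltW.
rewrite ler_wpDl ?(ltW s0) // mulrC ler_pdivlMr // expr2 ler_wpM2l // ltW //.
Qed.

Section martingale_increments.
Context d (T : measurableType d) (R : realType) (P : probability T R).
Variables (G : nat -> set (set T)) (D : T -> R) (a : nat -> T -> R).
Local Notation W n := (g_sigma_algebraType (G n)).
Hypotheses (GO : forall n, G n `<=` measurable)
  (G_incr : forall n, <<s G n>> `<=` <<s G n.+1>>).
Hypotheses (mD : measurable_fun setT D) (D_ge0 : forall x, 0 <= D x)
  (D_fin : (\int[P]_x (D x)%:E < +oo)%E).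
Hypotheses (ma : forall n, measurable_fun setT (a n : W n -> R))
  (a_ge0 : forall n x, 0 <= a n x).
Hypothesis aE : forall n A, <<s G n>> A ->
  (\int[P]_(x in A) (a n x)%:E = \int[P]_(x in A) (D x)%:E)%E.

Let mO n : <<s G n>> `<=` @measurable _ T.
Proof. exact: (smallest_sub (@sigma_algebra_measurable _ T) (@GO n)). Qed.
Let mid n : measurable_fun setT (id : T -> W n).
Proof. by move=> _ A mA; rewrite setTI; exact: (@mO n A mA). Qed.
Let mT n (u : W n -> R) : measurable_fun setT u -> measurable_fun setT (u : T -> R).
Proof. by move=> mu; exact: (measurableT_comp mu (@mid n)). Qed.

(** Orthogonality gives E (c_n - c_{n+1})^2 = E c_{n+1}^2 - E c_n^2. The second moments therefore
    increase; they are bounded by K^2, so they converge and their differences tend to 0. *)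
Let bounded_increments (c : nat -> T -> R) (K : R) (D' : T -> R) :
  (forall n, measurable_fun setT (c n : W n -> R)) ->
  (forall n x, 0 <= c n x <= K) ->
  (forall n A, <<s G n>> A ->
    (\int[P]_(x in A) (c n x)%:E = \int[P]_(x in A) (D' x)%:E)%E) ->
  (fun n => \int[P]_x `|c n x - c n.+1 x|%:E)%E @ \oo --> 0%E.
Proof.
move=> mc cK cE.
have c0 n x : 0 <= c n x by case/andP: (cK n x).
have cleK n x : c n x <= K by case/andP: (cK n x).
have K0 : 0 <= K := le_trans (c0 0%N point) (cleK 0%N point).
have mcT n : measurable_fun setT (c n) by exact: mT.
have bd_prod n m : P.-integrable setT (EFin \o (fun x => c n x * c m x)).
  apply: (@bounded_probability_integrable _ _ _ P _ (K * K)).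
    exact: measurable_funM.
  by move=> x; rewrite normrM !ger0_norm // ler_pM.
pose q n m := fine (\int[P]_x (c n x * c m x)%:E)%E.
have qE n m : (\int[P]_x (c n x * c m x)%:E = (q n m)%:E)%E.
  by rewrite fineK //; exact: (integrable_fin_num measurableT (bd_prod n m)).
(* The weights [c n.+1] and [c n] have the same integrals over the sets of G_n, and the integrand
   [c n] is measurable for G_n. *)
have cross n : q n n.+1 = q n n.
  apply: EFin_inj; rewrite -!qE.
  under eq_integral do rewrite EFinM; under [RHS]eq_integral do rewrite EFinM.
  apply: (@integral_change _ _ _ T T (W n) R P P id id (c n.+1) (c n) _ _ _ _ _ _
    (EFin \o c n)) => //.
  - move=> A mA; rewrite cE ?cE //; exact: G_incr.
  - by apply/measurable_EFinP; exact: mc.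
  - by move=> x; rewrite lee_fin.
have sq n : (\int[P]_x ((c n x - c n.+1 x) ^+ 2)%:E = (q n.+1 n.+1 - q n n)%:E)%E.
  rewrite (_ : q n.+1 n.+1 - q n n = q n n + q n.+1 n.+1 - (q n n.+1 + q n n.+1)); last first.
    by rewrite cross; ring.
  rewrite EFinB !EFinD -!qE.
  rewrite -(integralD_EFin measurableT (bd_prod n n) (bd_prod n.+1 n.+1)).
  rewrite -(integralD_EFin measurableT (bd_prod n n.+1) (bd_prod n n.+1)).
  have i1 := integrableD measurableT (bd_prod n n) (bd_prod n.+1 n.+1).
  have i2 := integrableD measurableT (bd_prod n n.+1) (bd_prod n n.+1).
  rewrite -(integralB measurableT i1 i2).
  by apply: eq_integral => x _; rewrite /= -!EFinD; congr EFin; ring.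
pose r n := q n n.
have nd_r : nondecreasing_seq r.
  apply/nondecreasing_seqP => n; rewrite -subr_ge0 -lee_fin -sq.
  by apply: integral_ge0 => x _; rewrite lee_fin sqr_ge0.
have ub_r n : r n <= K * K.
  rewrite -lee_fin -qE -[leRHS](integral_probability_cst P).
  apply: ge0_le_integral => //.
  - by move=> x _; rewrite lee_fin mulr_ge0.
  - by apply/measurable_EFinP/measurable_funM.
  - by move=> x _; rewrite lee_fin ler_pM.
have r_cvg : cvgn r.
  apply: nondecreasing_is_cvgn => //; exists (K * K) => _ [n _ <-]; exact: ub_r.
have dr : (fun n => r n.+1 - r n) @ \oo --> (0 : R).
  rewrite -[X in _ --> X](subrr (limn r)); apply: cvgB => //.
  by rewrite (cvg_shiftS r).
apply: cvge0P => [n|eps eps0].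
  by apply: integral_ge0 => x _; rewrite lee_fin.
have e2 : 0 < eps / 2 by rewrite divr_gt0.
(* A squared distance of at most (eps/2)^2 makes both terms of [norm_le_sqr], taken at s = eps/2, at
   most eps/2. *)
have /cvgrPdist_le/(_ _ (mulr_gt0 e2 e2))[N _ HN] := dr.
exists N => n Nn.
apply: (@le_trans _ _ (\int[P]_x ((eps / 2)%:E +
    ((eps / 2)^-1)%:E * ((c n x - c n.+1 x) ^+ 2)%:E))%E).
  apply: ge0_le_integral => //.
  - by apply/measurable_EFinP/measurableT_comp => //; exact: measurable_funB.
  - apply: emeasurable_funD => //; apply: measurable_funeM.
    exact/measurable_EFinP/measurable_funX/measurable_funB.
  - move=> x _; rewrite -EFinM -EFinD lee_fin.
    exact: norm_le_sqr.
have msq : measurable_fun setT (fun x => ((c n x - c n.+1 x) ^+ 2)%:E).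
  exact/measurable_EFinP/measurable_funX/measurable_funB.
have se0 : 0 <= (eps / 2)^-1 by rewrite invr_ge0 ltW.
rewrite ge0_integralD //.
- rewrite integral_probability_cst ge0_integralZl_EFin //; last first.
    by move=> x _; rewrite lee_fin sqr_ge0.
  rewrite sq -EFinM -EFinD lee_fin.
  have := HN n Nn; rewrite sub0r normrN => /(le_trans (ler_norm _)) H.
  by rewrite [leRHS](splitr eps) lerD2l mulrC ler_pdivrMr.
- by move=> x _; rewrite lee_fin ltW.
- by move=> x _; rewrite mule_ge0 // lee_fin ?sqr_ge0.
- exact: measurable_funeM.
Qed.

(** The level [K] is chosen before n: by contraction, the distance from [a n] to its bounded
    counterpart [c n] is at most the truncation error of [D], uniformly in n. One third of [eps]
    goes to each of the two replacements and one to the bounded increment. *)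
Lemma martingale_increments_cvg0 :
  (fun n => \int[P]_x `|a n x - a n.+1 x|%:E)%E @ \oo --> 0%E.
Proof.
have iD : P.-integrable setT (EFin \o D) by exact: ge0_integrable.
have maT n : measurable_fun setT (a n) by exact: mT.
have ia n : P.-integrable setT (EFin \o a n).
  apply: ge0_integrable => //; rewrite aE //; exact: (@measurableT _ (W n)).
apply: cvge0P => [n|eps eps0].
  by apply: integral_ge0 => x _; rewrite lee_fin.
have e3 : 0 < eps / 3 by rewrite divr_gt0.
have [K HK] := truncation_error mD D_ge0 iD e3.
pose DK x := Num.min (D x) K%:R.
have mDK : measurable_fun setT DK by exact: measurable_minr.
have DK0K x : 0 <= DK x <= K%:R by rewrite le_min D_ge0 ler0n ge_min lexx orbT.
have iDK : P.-integrable setT (EFin \o DK).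
  apply: (bounded_probability_integrable P mDK (M := K%:R)) => x.
  by have /andP[H1 H2] := DK0K x; rewrite ger0_norm.
have /choice[c Hc] : forall n, exists b : T -> R,
    [/\ measurable_fun setT (b : W n -> R), (forall x, 0 <= b x <= K%:R) &
     forall A, <<s G n>> A ->
       (\int[P]_(x in A) (DK x)%:E = \int[P]_(x in A) (b x)%:E)%E].
  by move=> n; exact: (bounded_conditional_expectation P (@mid n) mDK DK0K).
have mc n : measurable_fun setT (c n : W n -> R) by have [] := Hc n.
have mcT n : measurable_fun setT (c n) by exact: mT.
have cK n x : 0 <= c n x <= K%:R by have [_ ->] := Hc n.
have cE n A : <<s G n>> A ->
    (\int[P]_(x in A) (c n x)%:E = \int[P]_(x in A) (DK x)%:E)%E.
  by move=> sA; have [_ _ ->] := Hc n.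
have ic n : P.-integrable setT (EFin \o c n).
  apply: (bounded_probability_integrable P (mcT n) (M := K%:R)) => x.
  by have /andP[H1 H2] := cK n x; rewrite ger0_norm.
have close n : (\int[P]_x `|a n x - c n x|%:E <= (eps / 3)%:E)%E.
  apply: le_trans HK.
  by apply: (conditional_expectation_contraction (@GO n)) => //; [exact: aE|exact: cE].
have /fine_cvgP[[N1 _ H1] /cvgrPdist_le/(_ _ e3)[N2 _ H2]] := bounded_increments mc cK cE.
exists (maxn N1 N2) => n; rewrite geq_max => /andP[n1 n2].
have mid3 : (\int[P]_x `|c n x - c n.+1 x|%:E <= (eps / 3)%:E)%E.
  rewrite -[leLHS]fineK ?lee_fin; last exact: H1.
  have := H2 n n2; rewrite sub0r normrN; exact: le_trans (ler_norm _).
have mabs (u v : T -> R) : measurable_fun setT u -> measurable_fun setT v ->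
    measurable_fun setT (fun x => `|u x - v x|%:E).
  by move=> mu mv; apply/measurable_EFinP/measurableT_comp => //; exact: measurable_funB.
apply: (@le_trans _ _ (\int[P]_x (`|a n x - c n x|%:E +
    (`|c n x - c n.+1 x|%:E + `|a n.+1 x - c n.+1 x|%:E)))%E).
  apply: ge0_le_integral => //.
  - exact: mabs.
  - by apply: emeasurable_funD; [|apply: emeasurable_funD]; exact: mabs.
  - move=> x _; rewrite -!EFinD lee_fin (distrC (a n.+1 x)).
    apply: le_trans (ler_distD (c n x) _ _) _; rewrite lerD2l.
    exact: ler_distD.
rewrite ge0_integralD //; last 3 first.
- exact: mabs.
- by move=> x _; rewrite -EFinD lee_fin addr_ge0.
- by apply: emeasurable_funD; exact: mabs.
rewrite ge0_integralD //; last 2 first.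
- exact: mabs.
- exact: mabs.
rewrite (_ : eps = eps / 3 + (eps / 3 + eps / 3)); last by field.
by rewrite !EFinD; apply: leeD => //; exact: leeD.
Qed.
End martingale_increments.

(** * Hidden Markov laws *)

Section chain_probability.
Context (R : realType) d (X : measurableType d) (T : R.-pker X ~> X).

Lemma chain_prob_ge0 m A x : (0 <= chain_prob T m A x)%E.
Proof.
elim: m A x => [|m IH] A x /=; first exact: lee01.
by apply: integral_ge0 => y _; exact: IH.
Qed.

Lemma measurable_chain_prob m A : (forall i, measurable (A i)) ->
  measurable_fun setT (chain_prob T m A).
Proof.
elim: m A => [|m IH] A mA /=; first exact: measurable_cst.
under eq_fun do rewrite integral_mkcond.
apply: measurable_fun_integral_kernel.
- by move=> U mU; exact: measurable_kernel.
- by apply: erestrict_ge0 => y _; exact: chain_prob_ge0.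
- apply/(measurable_restrictT _ (mA 1%N)).1; apply: measurable_funTS.
  exact: (IH (fun i => A i.+1)).
Qed.

Lemma chain_prob_le1 m A x : (forall i, measurable (A i)) ->
  (chain_prob T m A x <= 1)%E.
Proof.
elim: m A x => [|m IH] A x mA //=.
apply: (@le_trans _ _ (\int[T x]_(y in A 1%N) 1%E)%E).
  apply: ge0_le_integral => //.
  - by move=> y _; exact: chain_prob_ge0.
  - by apply: measurable_funTS; exact: (measurable_chain_prob m (A := fun i => A i.+1)).
  - by move=> y _; exact: IH.
rewrite integral_cst // mul1e -(@prob_kernel _ _ _ _ _ T x).
by apply: le_measure => //; rewrite inE.
Qed.

Lemma chain_prob_fin_num m A x : (forall i, measurable (A i)) ->
  chain_prob T m A x \is a fin_num.
Proof.
move=> mA; rewrite ge0_fin_numE ?chain_prob_ge0 //.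
exact: le_lt_trans (chain_prob_le1 m x mA) (ltry 1).
Qed.

End chain_probability.

Section cylinders.
Context dX dZ dO (X : measurableType dX) (Z : measurableType dZ)
  (O : measurableType dO) (Xs : nat -> O -> X) (Zs : nat -> O -> Z).
Hypotheses (mXs : forall n, measurable_fun setT (Xs n))
  (mZs : forall n, measurable_fun setT (Zs n)).

Definition cylinder (n : nat) (A : nat -> set X) (B : nat -> set Z) : set O :=
  \bigcap_(i in [set i | (i <= n)%N]) (Xs i @^-1` A i `&` Zs i @^-1` B i).

(** A pi-system generating sigma(X_0, Z_0, ..., X_n, Z_n), made of the events whose probability
    [hmm_law] prescribes. Leaving Z_n free below gives sigma(X_0, Z_0, ..., Z_{n-1}, X_n). *)
Definition cylinders (n : nat) : set (set O) :=
  [set S | exists A B, [/\ forall i, measurable (A i), forall i, measurable (B i) &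
    S = cylinder n A B]].

(* The last coordinate Zs n is left free. *)
Definition open_cylinders (n : nat) : set (set O) :=
  [set S | exists A B, [/\ forall i, measurable (A i), forall i, measurable (B i),
    B n = setT & S = cylinder n A B]].

Lemma measurable_cylinder n A B : (forall i, measurable (A i)) ->
  (forall i, measurable (B i)) -> measurable (cylinder n A B).
Proof.
move=> mA mB; apply: bigcap_measurable => [|i _]; first by exists 0%N.
by apply: measurableI; exact: preimage_measurable.
Qed.

Lemma cylinderI n A B A' B' : cylinder n A B `&` cylinder n A' B' =
  cylinder n (fun i => A i `&` A' i) (fun i => B i `&` B' i).
Proof.
apply/seteqP; split => w.
  by move=> [H H'] i ni; have [? ?] := H i ni; have [? ?] := H' i ni.
by move=> H; split => i ni; have [[? ?] [? ?]] := H i ni.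
Qed.

Lemma cylinderT n : cylinder n (fun=> setT) (fun=> setT) = setT.
Proof. by apply/seteqP; split. Qed.

Lemma cylindersI n : setI_closed (cylinders n).
Proof.
move=> _ _ [A [B [mA mB ->]]] [A' [B' [mA' mB' ->]]]; rewrite cylinderI.
exists (fun i => A i `&` A' i), (fun i => B i `&` B' i).
by split => // i; exact: measurableI.
Qed.

Lemma open_cylindersI n : setI_closed (open_cylinders n).
Proof.
move=> _ _ [A [B [mA mB Bn ->]]] [A' [B' [mA' mB' Bn' ->]]]; rewrite cylinderI.
exists (fun i => A i `&` A' i), (fun i => B i `&` B' i).
by split => // [i|i|]; rewrite ?Bn ?Bn' ?setIT //; exact: measurableI.
Qed.

Lemma cylindersT n : cylinders n setT.
Proof. by exists (fun=> setT), (fun=> setT); rewrite cylinderT. Qed.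

Lemma open_cylindersT n : open_cylinders n setT.
Proof. by exists (fun=> setT), (fun=> setT); rewrite cylinderT. Qed.

Lemma preimage_X_cylinder n i (A : set X) : (i <= n)%N ->
  Xs i @^-1` A = cylinder n (fun j => if j == i then A else setT) (fun=> setT).
Proof.
move=> ni; apply/seteqP; split => w /=.
  by move=> wA j _; split => //=; case: eqP => // ->.
by move=> /(_ i ni)[/=]; rewrite eqxx.
Qed.

Lemma preimage_Z_cylinder n i (B : set Z) : (i <= n)%N ->
  Zs i @^-1` B = cylinder n (fun=> setT) (fun j => if j == i then B else setT).
Proof.
move=> ni; apply/seteqP; split => w /=.
  by move=> wB j _; split => //=; case: eqP => // ->.
by move=> /(_ i ni)[_ /=]; rewrite eqxx.
Qed.

Lemma open_cylinders_sub n : open_cylinders n `<=` cylinders n.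
Proof. by move=> _ [A [B [mA mB _ ->]]]; exists A, B. Qed.

Lemma cylinders_measurable n : cylinders n `<=` measurable.
Proof. by move=> _ [A [B [mA mB ->]]]; exact: measurable_cylinder. Qed.

Lemma measurable_X_open_cylinders n i : (i <= n)%N ->
  measurable_fun setT (Xs i : g_sigma_algebraType (open_cylinders n) -> X).
Proof.
move=> ni _ A mA; rewrite setTI (preimage_X_cylinder _ ni).
apply: sub_sigma_algebra; exists (fun j => if j == i then A else setT), (fun=> setT).
by split => // j; case: eqP.
Qed.

Lemma measurable_Z_open_cylinders n i : (i < n)%N ->
  measurable_fun setT (Zs i : g_sigma_algebraType (open_cylinders n) -> Z).
Proof.
move=> ni _ B mB; rewrite setTI (preimage_Z_cylinder _ (ltnW ni)).
apply: sub_sigma_algebra; exists (fun=> setT), (fun j => if j == i then B else setT).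
by split => // [j|]; [case: eqP|case: eqP ni => // ->; rewrite ltnn].
Qed.

Lemma measurable_X_cylinders n i : (i <= n)%N ->
  measurable_fun setT (Xs i : g_sigma_algebraType (cylinders n) -> X).
Proof.
move=> ni _ A mA; rewrite setTI (preimage_X_cylinder _ ni).
apply: sub_sigma_algebra; exists (fun j => if j == i then A else setT), (fun=> setT).
by split => // j; case: eqP.
Qed.

Lemma measurable_Z_cylinders n i : (i <= n)%N ->
  measurable_fun setT (Zs i : g_sigma_algebraType (cylinders n) -> Z).
Proof.
move=> ni _ B mB; rewrite setTI (preimage_Z_cylinder _ ni).
apply: sub_sigma_algebra; exists (fun=> setT), (fun j => if j == i then B else setT).
by split => // j; case: eqP.
Qed.

End cylinders.

Section hmm_laws.
Context (R : realType) dX dZ dO (X : measurableType dX) (Z : measurableType dZ)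
  (O : measurableType dO) (T : R.-pker X ~> X) (Q : probability Z R)
  (Xs : nat -> O -> X) (Zs : nat -> O -> Z).
Hypotheses (mXs : forall n, measurable_fun setT (Xs n))
  (mZs : forall n, measurable_fun setT (Zs n)).
Local Notation cyl := (cylinder Xs Zs).

(** On an open cylinder, placing [C] in the free slot changes only the last factor of the product,
    from 1 to [Q C]. Independence extends from this pi-system by comparing the weights 1_{Z_n in C}
    and [Q C]. *)
Lemma hmm_noise_independent (P : probability O R) (mu : probability X R) n S (C : set Z) :
  hmm_law P mu T Q Xs Zs -> measurable C -> <<s open_cylinders Xs Zs n>> S ->
  (P (S `&` Zs n @^-1` C) = Q C * P S)%E.
Proof.
move=> law mC sS.
have mZC : measurable (Zs n @^-1` C) by exact: preimage_measurable.
have OM : open_cylinders Xs Zs n `<=` measurable.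
  exact: subset_trans (@open_cylinders_sub _ _ _ _ _ _ Xs Zs n) (cylinders_measurable mXs mZs (n := n)).
have sO : <<s open_cylinders Xs Zs n>> `<=` @measurable _ O.
  exact: (smallest_sub (@sigma_algebra_measurable _ O) OM).
have mS := sO _ sS.
have QC : Q C = (fine (Q C))%:E by rewrite fineK // fin_num_measure.
have lhs A : measurable A ->
    (\int[P]_(w in A) (\1_(Zs n @^-1` C) w)%:E = P (A `&` Zs n @^-1` C))%E.
  by move=> mA; rewrite integral_indic // setIC.
have rhs A : measurable A -> (\int[P]_(w in A) (fine (Q C))%:E = Q C * P A)%E.
  by move=> mA; rewrite integral_cst // QC.
rewrite -lhs // -rhs //.
apply: (@weighted_pi_unique _ O R P P (\1_(Zs n @^-1` C)) (fun=> fine (Q C))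
  (open_cylinders Xs Zs n)) => //.
- by move=> _; rewrite fine_ge0.
- exact: open_cylindersI.
- exact: open_cylindersT.
- rewrite lhs // setTI -ge0_fin_numE // fin_num_measure //.
move=> A oA; rewrite lhs ?rhs; [|exact: OM|exact: OM].
move: oA => [A' [B [mA mB Bn ->]]].
rewrite (_ : cyl n A' B `&` _ = cyl n A' (fun i => if i == n then C else B i)); last first.
  apply/seteqP; split => w.
    by move=> [H wC] i ni; have [? ?] := H i ni; split => //=; case: eqP => // ->.
  move=> H; split; last by have [_ /=] := H n (leqnn n); rewrite eqxx.
  move=> i ni; have [? /=] := H i ni; split => //=.
  by case: eqP b => // -> _; rewrite Bn.
rewrite !law //; last by move=> i; case: eqP.
rewrite !big_ord_recr /= eqxx Bn.
rewrite (eq_bigr (fun i : 'I_n => Q (B i))); last first.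
  by move=> i _; rewrite ltn_eqF.
have -> : Q setT = 1%E by exact: probability_setT.
by rewrite mule1 muleA muleC.
Qed.

Variables (mu nu : probability X R) (Pmu Pnu : probability O R).
Hypotheses (lawmu : hmm_law Pmu mu T Q Xs Zs) (lawnu : hmm_law Pnu nu T Q Xs Zs).
Variable f : X -> R.
Hypotheses (mf : measurable_fun setT f) (f_ge0 : forall x, 0 <= f x).
Hypothesis f_dens : forall A, measurable A -> mu A = (\int[nu]_(x in A) (f x)%:E)%E.

(** The two laws share the kernel and the noise and differ only in the initial law, so the density
    of [mu] at X_0 is the density on every finite horizon. *)
Lemma hmm_density n S : <<s cylinders Xs Zs n>> S ->
  Pmu S = (\int[Pnu]_(w in S) (f (Xs 0%N w))%:E)%E.
Proof.
move=> sS.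
have CM := cylinders_measurable mXs mZs (n := n).
have mS := smallest_sub (@sigma_algebra_measurable _ O) CM sS.
rewrite -integral_one //; move: S sS {mS}.
have mfX : measurable_fun setT (fun w => f (Xs 0%N w)) by exact: measurableT_comp.
apply: weighted_pi_unique => //.
- exact: cylindersI.
- exact: cylindersT.
- by rewrite integral_probability_cst ltry.
move=> _ [A [B [mA mB ->]]].
have mC := measurable_cylinder mXs mZs n mA mB.
rewrite integral_one //. etransitivity; first exact: (lawmu n mA mB).
set q := (\prod_(i < n.+1) Q (B i))%E.
have [r r0 qr] : exists2 r : R, 0 <= r & q = r%:E.
  rewrite /q; elim: n.+1 => [|m [r r0 IH]]; first by exists 1; rewrite ?big_ord0.
  rewrite big_ord_recr /= IH; exists (r * fine (Q (B m))).
    by rewrite mulr_ge0 // fine_ge0.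
  by rewrite EFinM fineK // fin_num_measure.
pose c x := fine (chain_prob T n A x).
have cE x : chain_prob T n A x = (c x)%:E by rewrite fineK // chain_prob_fin_num.
have c0 x : 0 <= c x by rewrite fine_ge0 // chain_prob_ge0.
have mc : measurable_fun setT c.
  by apply: measurableT_comp => //; exact: measurable_chain_prob.
have mI : measurable_fun setT (\1_(A 0%N) : X -> R) by exact: measurable_indic.
(* The probability of the cylinder given X_0 = x, which is the same under both laws. *)
pose u2 x : R := \1_(A 0%N) x * c x * r.
have mu2 : measurable_fun setT u2 by apply: measurable_funM => //; exact: measurable_funM.
have u20 x : 0 <= u2 x by rewrite !mulr_ge0.
have H : (\int[Pnu]_w ((f (Xs 0%N w))%:E * (\1_(cyl n A B) w)%:E) =
    \int[nu]_x ((f x)%:E * (u2 x)%:E))%E.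
  apply: (@integral_change _ _ _ O X X R Pnu nu (Xs 0%N) id (\1_(cyl n A B)) u2
    _ _ _ _ _ _ (EFin \o f)) => //; last exact/measurable_EFinP.
  move=> A' mA'.
  rewrite integral_indic //; last exact: preimage_measurable.
  (* The condition X_0 in A' is absorbed into the initial set, which [chain_prob] never reads. *)
  pose A2 i := if i is 0%N then A 0%N `&` A' else A i.
  rewrite (_ : cyl n A B `&` _ = cyl n A2 B); last first.
    apply/seteqP; split => w.
      move=> [H wA'] i ni; have [Hx Hz] := H i ni; split => //.
      by case: i ni Hx {Hz} => [_ Hx|i _ Hx]; [split|exact: Hx].
    move=> H; split; last by have [[_ ?] _] := H 0%N (leq0n n).
    move=> i ni; have [Hx Hz] := H i ni; split => //.
    by case: i ni Hx {Hz} => [_ [Hx _]|i _ Hx]; exact: Hx.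
  have mA2 i : measurable (A2 i) by case: i => [|i]; [exact: measurableI|exact: mA].
  etransitivity; first exact: (lawnu n mA2 mB).
  have -> : chain_prob T n A2 = chain_prob T n A by case: (n).
  rewrite -/q qr -ge0_integralZr //; first last.
  - by move=> x _; exact: chain_prob_ge0.
  - by apply: measurable_funTS; exact: measurable_chain_prob.
  rewrite (_ : A2 0%N = A' `&` A 0%N); last by rewrite setIC.
  rewrite integral_mkcondr; apply: eq_integral => x _.
  rewrite patchE /u2 indicE cE; case: ifP => _; rewrite ?mul1r ?mul0r //.
transitivity (\int[Pnu]_w ((f (Xs 0%N w))%:E * (\1_(cyl n A B) w)%:E))%E; last first.
  rewrite [RHS]integral_mkcond; apply: eq_integral => w _.
  by rewrite patchE indicE; case: ifP; rewrite ?mule1 ?mule0.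
rewrite H -/q qr.
have H2 : (\int[mu]_x ((\1_(A 0%N) x * c x)%:E * 1%:E) =
    \int[nu]_x ((\1_(A 0%N) x * c x)%:E * (f x)%:E))%E.
  apply: (@integral_change _ _ _ X X X R mu nu id id (fun=> 1) f
    _ _ _ _ _ _ (fun x => (\1_(A 0%N) x * c x)%:E)) => //.
  - by move=> A' mA'; rewrite integral_one //; exact: f_dens.
  - exact/measurable_EFinP/measurable_funM.
  - by move=> x; rewrite lee_fin mulr_ge0.
transitivity (\int[mu]_x ((\1_(A 0%N) x * c x)%:E * 1%:E) * r%:E)%E.
  congr (_ * _)%E; rewrite integral_mkcond; apply: eq_integral => x _.
  by rewrite patchE indicE mule1 cE; case: ifP; rewrite ?mul1r ?mul0r.
rewrite H2 -ge0_integralZr //.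
- by apply: eq_integral => x _; rewrite -!EFinM /u2; congr EFin; ring.
- by apply: emeasurable_funM; apply/measurable_EFinP => //; exact: measurable_funM.
- by move=> x _; rewrite -EFinM lee_fin !mulr_ge0.
Qed.

End hmm_laws.

(** * Sigma-algebras of observations *)

Section observations.
Context (R : realType) dX dY dZ dO (X : measurableType dX) (Y : measurableType dY)
  (Z : measurableType dZ) (O : measurableType dO).
Variables (T : R.-pker X ~> X) (Q : probability Z R) (h : X * Z -> Y).
Hypothesis mh : measurable_fun setT h.
Variables (Xs : nat -> O -> X) (Zs : nat -> O -> Z).
Hypotheses (mXs : forall n, measurable_fun setT (Xs n))
  (mZs : forall n, measurable_fun setT (Zs n)).
Variables (mu nu : probability X R) (Pmu Pnu : probability O R).
Hypotheses (lawmu : hmm_law Pmu mu T Q Xs Zs) (lawnu : hmm_law Pnu nu T Q Xs Zs).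

(** The generator in [obs_sigma], named so that the generated sigma-algebra can serve as a
    measurable type. It contains Y_0, ..., Y_{n-1}: index n is the predictor at time n, index n+1
    the filter. *)
Definition obs_gen n : set (set O) :=
  [set A | exists i B, [/\ (i < n)%N, measurable B & A = obs h Xs Zs i @^-1` B]].
Local Notation W n := (g_sigma_algebraType (obs_gen n)).

Lemma measurable_obs d (O' : measurableType d) (Xi : O' -> X) (Zi : O' -> Z) :
  measurable_fun setT Xi -> measurable_fun setT Zi ->
  measurable_fun setT (fun w => h (Xi w, Zi w)).
Proof. by move=> mX mZ; apply: (measurableT_comp mh); exact: measurable_fun_pair. Qed.

Lemma obs_gen_measurable n : obs_gen n `<=` measurable.
Proof.
move=> _ [i [B [_ mB ->]]].
by apply: preimage_measurable => //; exact: (measurable_obs (mXs i) (mZs i)).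
Qed.

Lemma obs_gen_incr n : <<s obs_gen n>> `<=` <<s obs_gen n.+1>>.
Proof.
apply: smallest_sub; first exact: smallest_sigma_algebra.
move=> _ [i [B [ni mB ->]]]; apply: sub_sigma_algebra.
by exists i, B; split => //; exact: ltnW.
Qed.

(** Observations before time n do not involve Z_n. This is what makes them, jointly with X_n,
    independent of Z_n. *)
Lemma obs_open_cylinders n :
  <<s obs_gen n>> `<=` <<s open_cylinders Xs Zs n>>.
Proof.
apply: smallest_sub; first exact: smallest_sigma_algebra.
move=> _ [i [B [ni mB ->]]].
apply: (@preimage_measurable _ _ (g_sigma_algebraType (open_cylinders Xs Zs n)) Y) => //.
exact: (measurable_obs (@measurable_X_open_cylinders _ _ _ _ _ _ Xs Zs _ _ (ltnW ni))
  (@measurable_Z_open_cylinders _ _ _ _ _ _ Xs Zs _ _ ni)).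
Qed.

Lemma obs_cylinders n : <<s obs_gen n.+1>> `<=` <<s cylinders Xs Zs n>>.
Proof.
apply: smallest_sub; first exact: smallest_sigma_algebra.
move=> _ [i [B [ni mB ->]]].
apply: (@preimage_measurable _ _ (g_sigma_algebraType (cylinders Xs Zs n)) Y) => //.
have ni' : (i <= n)%N by [].
exact: (measurable_obs (@measurable_X_cylinders _ _ _ _ _ _ Xs Zs _ _ ni')
  (@measurable_Z_cylinders _ _ _ _ _ _ Xs Zs _ _ ni')).
Qed.

Definition obs_state n (w : O) : W n * X := (w, Xs n w).

Lemma obs_state_open_cylinders n (S : set (W n * X)) : measurable S ->
  <<s open_cylinders Xs Zs n>> (obs_state n @^-1` S).
Proof.
move=> mS.
apply: (@preimage_measurable _ _ (g_sigma_algebraType (open_cylinders Xs Zs n)) (W n * X)%type) => //.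
apply: measurable_fun_pair.
  by move=> _ A mA; rewrite setTI; exact: (obs_open_cylinders mA).
exact: (@measurable_X_open_cylinders _ _ _ _ _ _ Xs Zs _ _ (leqnn n)).
Qed.

Lemma measurable_obs_state n : measurable_fun setT (obs_state n).
Proof.
apply: measurable_fun_pair => // _ A mA; rewrite setTI.
exact: (smallest_sub (@sigma_algebra_measurable _ O) (@obs_gen_measurable n)).
Qed.

(* The new observation depends on the past only through Xs n and the independent
   noise Zs n, so the density on sigma(obs_gen n, Xs n) is still one after adding it. *)
Lemma density_add_observation n (phi : W n * X -> R) :
  measurable_fun setT phi -> (forall z, 0 <= phi z) ->
  (forall S, measurable S -> Pmu (obs_state n @^-1` S) =
    (\int[Pnu]_(w in obs_state n @^-1` S) (phi (obs_state n w))%:E)%E) ->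
  forall S : set (W n.+1 * X), measurable S ->
    Pmu ((fun w => (w, Xs n w)) @^-1` S) =
    (\int[Pnu]_(w in (fun w => (w, Xs n w)) @^-1` S) (phi (w, Xs n w))%:E)%E.
Proof.
move=> mphi phi0 dens.
(* A pi-system generating sigma(G_n, X_n, Z_n), which is large enough to contain Y_n = h(X_n, Z_n).
   On its members both sides factor, with the common factor [Q C]. *)
pose G : set (set O) := [set S | exists F C, [/\ measurable F, measurable C &
  S = obs_state n @^-1` F `&` Zs n @^-1` C]].
have mst := @measurable_obs_state n.
have mZC C : measurable C -> measurable (Zs n @^-1` C).
  by move=> mC; exact: preimage_measurable.
have GO : G `<=` measurable.
  move=> _ [F [C [mF mC ->]]]; apply: measurableI; last exact: mZC.
  exact: preimage_measurable.
have GI : setI_closed G.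
  move=> _ _ [F [C [mF mC ->]]] [F' [C' [mF' mC' ->]]].
  exists (F `&` F'), (C `&` C'); split; [exact: measurableI|exact: measurableI|].
  by rewrite !preimage_setI setIACA.
have GT : G setT by exists setT, setT; split => //; rewrite !preimage_setT setIT.
have mphiO : measurable_fun setT (fun w => phi (obs_state n w)).
  exact: measurableT_comp.
have key S : <<s G>> S -> Pmu S = (\int[Pnu]_(w in S) (phi (obs_state n w))%:E)%E.
  move=> sS; have mS := smallest_sub (@sigma_algebra_measurable _ O) GO sS.
  rewrite -integral_one //; move: S sS {mS}; apply: weighted_pi_unique => //.
    by rewrite integral_probability_cst ltry.
  move=> _ [F [C [mF mC ->]]].
  have mF' : measurable (obs_state n @^-1` F) by exact: preimage_measurable.
  rewrite integral_one; last by apply: measurableI => //; exact: mZC.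
  transitivity (Q C * Pmu (obs_state n @^-1` F))%E.
    exact: (hmm_noise_independent mXs mZs lawmu mC (obs_state_open_cylinders mF)).
  rewrite dens //.
  (* Under [Pnu], the indicator of Z_n in C may be replaced by the constant [Q C] against any
     nonnegative function of [obs_state n]. *)
  have H : (\int[Pnu]_w (((\1_F (obs_state n w))%:E * (phi (obs_state n w))%:E) *
        (\1_(Zs n @^-1` C) w)%:E) =
      \int[Pnu]_w (((\1_F (obs_state n w))%:E * (phi (obs_state n w))%:E) *
        (fine (Q C))%:E))%E.
    apply: (@integral_change _ _ _ O O (W n * X)%type R Pnu Pnu (obs_state n) (obs_state n)
      (\1_(Zs n @^-1` C)) (fun=> fine (Q C)) _ _ _ _ _ _
      (fun z => (\1_F z)%:E * (phi z)%:E)%E) => //.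
    - by apply: measurable_indic; exact: mZC.
    - by move=> _; rewrite fine_ge0.
    - move=> A mA; have mA' : measurable (obs_state n @^-1` A) by exact: preimage_measurable.
      rewrite integral_indic //; last exact: mZC.
      rewrite integral_cst // fineK ?fin_num_measure // setIC.
      exact: (hmm_noise_independent mXs mZs lawnu mC (obs_state_open_cylinders mA)).
    - by apply: emeasurable_funM; apply/measurable_EFinP.
    - by move=> z; rewrite mule_ge0 // lee_fin.
  transitivity (\int[Pnu]_w (((\1_F (obs_state n w))%:E * (phi (obs_state n w))%:E) *
        (\1_(Zs n @^-1` C) w)%:E))%E; last first.
    rewrite [RHS]integral_mkcond; apply: eq_integral => w _.
    rewrite patchE in_setI !indicE.
    rewrite -[w \in obs_state n @^-1` F]/(obs_state n w \in F).
    by case: (_ \in F); case: (_ \in _); rewrite /= ?mul1e ?mule1 ?mul0e ?mule0.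
  rewrite H ge0_integralZr //; last 3 first.
  - apply: emeasurable_funM; apply/measurable_EFinP => //.
    by apply: (measurableT_comp _ mst); exact: measurable_indic.
  - by move=> w _; rewrite mule_ge0 // lee_fin.
  - by rewrite lee_fin fine_ge0.
  by rewrite -integral_setI_weight fineK ?fin_num_measure // muleC.
(* It remains to see that G_{n+1} and X_n are contained in the sigma-algebra of [G]: earlier
   observations enter through [F], and Y_n is a function of X_n and Z_n. *)
move=> S mS; apply: key.
apply: (@preimage_measurable _ _ (g_sigma_algebraType G) (W n.+1 * X)%type) => //.
have mX : measurable_fun setT (Xs n : g_sigma_algebraType G -> X).
  move=> _ A mA; rewrite setTI; apply: sub_sigma_algebra.
  exists (setT `*` A), setT; split => //; first exact: measurableX.
  by rewrite preimage_setT setIT; apply/seteqP; split => w //= [].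
have mZ : measurable_fun setT (Zs n : g_sigma_algebraType G -> Z).
  move=> _ C mC; rewrite setTI; apply: sub_sigma_algebra.
  by exists setT, C; split => //; rewrite preimage_setT setTI.
apply: measurable_fun_pair => // _ A; rewrite setTI; move: A.
apply: smallest_sub; first exact: (@sigma_algebra_measurable _ (g_sigma_algebraType G)).
move=> _ [i [B [ni mB ->]]].
have [->|ni'] := eqVneq i n.
  by apply: (@preimage_measurable _ _ (g_sigma_algebraType G) Y) => //; exact: (measurable_obs mX mZ).
have {ni'}ni : (i < n)%N by rewrite ltn_neqAle ni' -ltnS.
apply: sub_sigma_algebra; exists ((obs h Xs Zs i @^-1` B) `*` setT), setT; split => //.
  by apply: measurableX => //; apply: sub_sigma_algebra; exists i, B.
by rewrite preimage_setT setIT; apply/seteqP; split => w //= [].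
Qed.

End observations.

(** * Comparison of filter and predictor *)

Lemma real_density d (X : measurableType d) (R : realType) (mu nu : probability X R) :
  mu `<< nu -> exists f : X -> R, [/\ measurable_fun setT f, (forall x, 0 <= f x) &
    forall A, measurable A -> mu A = (\int[nu]_(x in A) (f x)%:E)%E].
Proof.
move=> mu_nu.
have [g [g0 gfin gint gE]] := radon_nikodym_sigma_finite mu_nu.
exists (fine \o g); split.
- by apply: measurableT_comp => //; exact: (measurable_int _ gint).
- by move=> x; exact: fine_ge0.
move=> A mA; rewrite [LHS]gE //; apply: eq_integral => x _.
by rewrite /= fineK.
Qed.

Lemma squeeze_cvg0 (R : realType) (u v w : nat -> \bar R) : (forall n, 0 <= u n)%E ->
  (forall n, u n <= v n + w n)%E -> v @ \oo --> 0%E -> w @ \oo --> 0%E ->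
  u @ \oo --> 0%E.
Proof.
move=> u0 uvw v0 w0; apply: (@squeeze_cvge _ _ _ _ (cst 0%E) _ (fun n => v n + w n)%E).
- by near=> n; rewrite u0 uvw.
- exact: cvg_cst.
- by rewrite -[X in _ --> X](adde0 0%E); apply: cvgeD.
Unshelve. all: by end_near.
Qed.

Lemma le_integral_dist d (T : measurableType d) (R : realType)
  (P : {measure set T -> \bar R}) (u v w : T -> R) :
  measurable_fun setT u -> measurable_fun setT v -> measurable_fun setT w ->
  (\int[P]_x `|u x - w x|%:E <= \int[P]_x `|u x - v x|%:E + \int[P]_x `|v x - w x|%:E)%E.
Proof.
move=> mu mv mw.
have mB (f g : T -> R) : measurable_fun setT f -> measurable_fun setT g ->
    measurable_fun setT (fun x => `|f x - g x|%:E).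
  by move=> mf mg; apply/measurable_EFinP/measurableT_comp => //; exact: measurable_funB.
rewrite -ge0_integralD //; [|exact: mB|exact: mB].
apply: ge0_le_integral => //; [exact: mB|by apply: emeasurable_funD; exact: mB|].
by move=> x _; rewrite -EFinD lee_fin; exact: ler_distD.
Qed.

Unset Implicit Arguments.
Set Strict Implicit.
Set Printing Implicit Defensive.

Theorem theorem6 (R : realType) (dX dY dZ dO : measure_display)
  (X : measurableType dX) (Y : measurableType dY) (Z : measurableType dZ)
  (O : measurableType dO)
  (polX : polish_measurable R X) (polY : polish_measurable R Y)
  (polZ : polish_measurable R Z)
  (T : R.-pker X ~> X) (Q : probability Z R)
  (h : X * Z -> Y) (mh : measurable_fun setT h)
  (Xs : nat -> O -> X) (Zs : nat -> O -> Z)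
  (mXs : forall n, measurable_fun setT (Xs n))
  (mZs : forall n, measurable_fun setT (Zs n))
  (mu nu : probability X R) (mu_ll_nu : mu `<< nu)
  (Pmu Pnu : probability O R)
  (lawmu : hmm_law Pmu mu T Q Xs Zs) (lawnu : hmm_law Pnu nu T Q Xs Zs)
  (filt_mu filt_nu pred_mu pred_nu : nat -> O -> probability X R)
  (Hfmu : forall n, is_cond_dist Pmu (obs_sigma (obs h Xs Zs) n.+1) (Xs n) (filt_mu n))
  (Hfnu : forall n, is_cond_dist Pnu (obs_sigma (obs h Xs Zs) n.+1) (Xs n) (filt_nu n))
  (Hpmu : forall n, is_cond_dist Pmu (obs_sigma (obs h Xs Zs) n) (Xs n) (pred_mu n))
  (Hpnu : forall n, is_cond_dist Pnu (obs_sigma (obs h Xs Zs) n) (Xs n) (pred_nu n)) :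
  ((fun n => (\int[Pmu]_w TV (filt_mu n w) (filt_nu n w))%E) @ \oo --> 0%E) <->
  ((fun n => (\int[Pmu]_w TV (pred_mu n w) (pred_nu n w))%E) @ \oo --> 0%E).
Proof.
have [f [mf f0 fE]] := real_density mu_ll_nu.
pose D w := f (Xs 0%N w).
have mD : measurable_fun setT D by exact: measurableT_comp.
have D0 w : 0 <= D w by exact: f0.
have dens n S : <<s cylinders Xs Zs n>> S -> Pmu S = (\int[Pnu]_(w in S) (D w)%:E)%E.
  by move=> sS; exact: (hmm_density mXs mZs lawmu lawnu mf f0 fE sS).
have D_fin : (\int[Pnu]_w (D w)%:E < +oo)%E.
  rewrite -(dens 0%N); last exact: (@measurableT _ (g_sigma_algebraType (cylinders Xs Zs 0))).
  by rewrite -ge0_fin_numE // fin_num_measure.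
pose G n := obs_gen h Xs Zs n.
have GO n : G n `<=` measurable by exact: obs_gen_measurable.
have mid n : measurable_fun setT (id : O -> g_sigma_algebraType (G n)).
  move=> _ A mA; rewrite setTI.
  exact: (smallest_sub (@sigma_algebra_measurable _ O) (@GO n)).
(* The detour through G_{n+1} also covers n = 0, where there is no observation. *)
have Gcyl n : <<s G n>> `<=` <<s cylinders Xs Zs n>>.
  by apply: subset_trans (obs_gen_incr (n := n)) _; exact: obs_cylinders.
have /choice[a Ha] : forall n, exists b : O -> R,
    [/\ measurable_fun setT (b : g_sigma_algebraType (G n) -> R), (forall x, 0 <= b x) &
     forall A, <<s G n>> A ->
       (\int[Pnu]_(x in A) (D x)%:E = \int[Pnu]_(x in A) (b x)%:E)%E].
  move=> n; have [b [mb b0 bE]] := conditional_expectation (mid n) mD D0 D_fin.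
  by exists b; split => // A sA; exact: (bE A sA).
have ma n : measurable_fun setT (a n : g_sigma_algebraType (G n) -> R) by have [] := Ha n.
have a0 n w : 0 <= a n w by have [_ ->] := Ha n.
have aE n A : <<s G n>> A ->
    (\int[Pnu]_(x in A) (a n x)%:E = \int[Pnu]_(x in A) (D x)%:E)%E.
  by move=> sA; have [_ _ ->] := Ha n.
have a_dens n A : <<s G n>> A -> Pmu A = (\int[Pnu]_(w in A) (a n w)%:E)%E.
  by move=> sA; rewrite aE // (dens n) //; exact: Gcyl.
have mst n := measurable_obs_state mh mXs mZs (n := n).
(* M_n is [phi n (w, Xs n w)]. It is kept as a function of two arguments because Bayes' rule
   integrates the state for fixed observations. *)
have /choice[phi Hphi] : forall n, exists phi : O * X -> R,
    [/\ measurable_fun setT (phi : g_sigma_algebraType (G n) * X -> R),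
        (forall z, 0 <= phi z) &
     forall S : set (g_sigma_algebraType (G n) * X), measurable S ->
       (\int[Pnu]_(w in obs_state h Xs Zs n @^-1` S) (D w)%:E =
        \int[Pnu]_(w in obs_state h Xs Zs n @^-1` S) (phi (w, Xs n w))%:E)%E].
  move=> n; have [b [mb b0 bE]] := conditional_expectation (mst n) mD D0 D_fin.
  by exists b; split.
have mphi n : measurable_fun setT (phi n : g_sigma_algebraType (G n) * X -> R).
  by have [] := Hphi n.
have phi0 n z : 0 <= phi n z by have [_ ->] := Hphi n.
have phi_dens n (S : set (g_sigma_algebraType (G n) * X)) : measurable S ->
    Pmu ((fun w => (w, Xs n w)) @^-1` S) =
    (\int[Pnu]_(w in (fun w => (w, Xs n w)) @^-1` S) (phi n (w, Xs n w))%:E)%E.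
  move=> mS; have [_ _ <- //] := Hphi n; apply: (dens n).
  have := obs_state_open_cylinders mh mS; move: (_ @^-1` _).
  apply: smallest_sub; first exact: smallest_sigma_algebra.
  by apply: subset_trans (@sub_sigma_algebra _ setT _); exact: open_cylinders_sub.
have Xgen := polish_countable_generator polX.
have predE n : (\int[Pmu]_w TV (pred_mu n w) (pred_nu n w) =
    \int[Pnu]_w `|phi n (w, Xs n w) - a n w|%:E)%E.
  exact: (integral_TV (GO n) (mXs n) (Hpmu n) (Hpnu n) (mphi n) (phi0 n) (ma n) (a0 n)
    (@phi_dens n) (@a_dens n) Xgen).
(* The same [phi n] as for the predictor, now read on the larger sigma-algebra: only [a n] becomes
   [a n.+1]. *)
have filtE n : (\int[Pmu]_w TV (filt_mu n w) (filt_nu n w) =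
    \int[Pnu]_w `|phi n (w, Xs n w) - a n.+1 w|%:E)%E.
  have mphi' : measurable_fun setT (phi n : g_sigma_algebraType (G n.+1) * X -> R).
    have mid' : measurable_fun setT
        (id : g_sigma_algebraType (G n.+1) -> g_sigma_algebraType (G n)).
      by move=> _ A mA; rewrite setTI; exact: (obs_gen_incr mA).
    have mid2 : measurable_fun setT
        (id : g_sigma_algebraType (G n.+1) * X -> g_sigma_algebraType (G n) * X).
      apply/measurable_fun_pairP; split; last exact: measurable_snd.
      exact: (measurableT_comp mid' measurable_fst).
    exact: (measurableT_comp (mphi n) mid2).
  apply: (integral_TV (GO n.+1) (mXs n) (Hfmu n) (Hfnu n) mphi' (phi0 n) (ma n.+1)
    (a0 n.+1) _ (@a_dens n.+1) Xgen).
  exact: (density_add_observation mh mXs mZs lawmu lawnu (mphi n) (phi0 n) (@phi_dens n)).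
have incr : (fun n => \int[Pnu]_w `|a n w - a n.+1 w|%:E)%E @ \oo --> 0%E.
  have Gi n : <<s G n>> `<=` <<s G n.+1>> by exact: obs_gen_incr.
  exact: (martingale_increments_cvg0 GO Gi mD D0 D_fin ma a0 aE).
have maO n : measurable_fun setT (a n) by exact: (measurableT_comp (ma n) (mid n)).
have mM n : measurable_fun setT (fun w => phi n (w, Xs n w)).
  exact: (measurableT_comp (mphi n) (mst n)).
have TV_int_ge0 (k k' : nat -> O -> probability X R) n :
    (0 <= \int[Pmu]_w TV (k n w) (k' n w))%E.
  by apply: integral_ge0 => w _; exact: TV_ge0.
split=> lim0.
- apply: (squeeze_cvg0 _ _ lim0 incr) => n; first exact: TV_int_ge0.
  rewrite predE filtE; under [X in (_ + X)%E]eq_integral do rewrite distrC.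
  exact: le_integral_dist.
- apply: (squeeze_cvg0 _ _ lim0 incr) => n; first exact: TV_int_ge0.
  by rewrite predE filtE; exact: le_integral_dist.
Qed.
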